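(* Let $(\Omega,\mathbf{\Sigma},\mu)$ be a complete probability space and let $p=2k+2$ with $k\geq 1$ an integer. Let $X$ be a closed subspace of $L^p(\mu)$ containing the constants, and let $\mathcal{M}(X):=\{h\in X: hf\in X\ \ \forall f\in X\}$ be its multiplier algebra. Suppose that $\mathcal{M}(X)$ satisfies one of the following conditions: (1) $\mathcal{M}(X)$ is dense in $X$. (2) The intersection of $\mathcal{M}(X)+\overline{\mathcal{M}(X)}$ and the closed unit ball of $L^\infty(\mu)$ is $w^*$-dense in the closed unit ball of $L^\infty(\mu)$. Then any contractive projection $P$ on $X$ satisfying $P\mathbf{1}=\mathbf{1}$ is of the form $$Pf=\mathbb{E}(f\,|\,\mathbf{\Sigma}'),\quad \forall f\in X,$$ where $\mathbf{\Sigma}'$ is the sub $\sigma$-algebra generated by the functions in $\mathrm{Ran}\,P$.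
   Context: $L^p(\mu)=L^p(\Omega,\mathbf{\Sigma},\mu)$ consists of complex-valued functions; $\mathbf{1}$ is the constant function 1; $\overline{\mathcal{M}(X)}$ is the set of complex conjugates of functions in $\mathcal{M}(X)$. $\mathcal{M}(X)$ is a closed subalgebra of $L^\infty(\mu)$. The $w^*$-topology on $L^\infty(\mu)$ is that of the duality $L^\infty(\mu)=L^1(\mu)^*$. A projection on a Banach space $X$ is a nonzero linear operator $P:X\to X$ with $P^2=P$; it is contractive if $\|P\|=1$; $\mathrm{Ran}\,P$ is its range. The $\sigma$-algebra generated by a family of measurable functions is the smallest complete (containing all $\mu$-null sets) sub $\sigma$-algebra of $\mathbf{\Sigma}$ for which every function in the family is measurable. $\mathbb{E}(\cdot|\mathbf{\Sigma}')$ is the conditional expectation with respect to $\mu$. *)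

(* Defs.v *)
From HB Require Import structures.
From mathcomp Require Export all_boot all_order all_algebra complex.
From mathcomp Require Export all_classical all_reals all_analysis.
Export numFieldNormedType.Exports.

Set Implicit Arguments.
Unset Strict Implicit.
Unset Printing Implicit Defensive.

Local Open Scope classical_set_scope.
Local Open Scope ring_scope.
Local Open Scope complex_scope.

(* [R[i]] with the topology of its norm. *)
Definition Cfield (R : realType) : numFieldType := R[i].

Section ComplexLp.
Context d (T : measurableType d) (R : realType) (mu : {measure set T -> \bar R}).
Implicit Types (p : \bar R) (f g h : T -> R[i]) (X : set (T -> R[i])).

Definition Cmeasurable f : Prop :=
  measurable_fun setT (fun x => complex.Re (f x)) /\
  measurable_fun setT (fun x => complex.Im (f x)).

(* The norm of [R[i]] takes its values in [R[i]]; [complex.Re `|z|] is the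
   modulus of [z] as an element of [R]. *)
Definition CLnorm p f : \bar R :=
  Lnorm mu p (fun x => (complex.Re `|f x|)%:E).

(* An element of the complex space L^p is handled through its representatives:
   two functions represent the same element iff they are equal mu-a.e. *)
Definition CLp p : set (T -> R[i]) :=
  [set f | Cmeasurable f /\ (CLnorm p f < +oo)%E].

Definition CLp_closure p X : set (T -> R[i]) :=
  [set f | CLp p f /\
    forall e : R, 0 < e -> exists2 g, X g & (CLnorm p (f \- g)%R < e%:E)%E].

(* [X] is the set of all representatives of the elements of a closed subspace
   of L^p, whence the stability under a.e. equality. *)
Record closed_subspace p X : Prop := ClosedSubspace {
  closed_subspace_sub : X `<=` CLp p ;
  closed_subspace_ae : forall f g,
    X f -> Cmeasurable g -> f = g %[ae mu] -> X g ;
  closed_subspace0 : X (cst 0) ;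
  closed_subspaceD : forall f g, X f -> X g -> X (f \+ g) ;
  closed_subspaceZ : forall (c : R[i]) f, X f -> X (fun x => c * f x) ;
  closed_subspace_closed : CLp_closure p X `<=` X }.

Definition multiplier_algebra X : set (T -> R[i]) :=
  [set h | X h /\ forall f, X f -> X (h \* f)].

Definition Cintegral (D : set T) f : R[i] :=
  (\int[mu]_(x in D) complex.Re (f x)) +i* (\int[mu]_(x in D) complex.Im (f x)).

Definition wstar_pairing (g : CLp +oo) : {ptws CLp 1 -> Cfield R} :=
  fun phi => Cintegral setT (val g \* val phi).

(* L^oo with the w*-topology: the coarsest topology making [g |-> \int g phi]
   continuous for every [phi] in L^1. *)
Definition wstar_Linf := initial_topology wstar_pairing.

HB.instance Definition _ :=
  Topological.copy wstar_Linf (initial_topology wstar_pairing).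

Definition Linf_ball : set wstar_Linf :=
  [set g : CLp +oo | (CLnorm +oo (val g) <= 1)%E].

Definition sum_conj X : set wstar_Linf :=
  [set g : CLp +oo | exists h1 h2,
     [/\ X h1, X h2 & val g = (fun x => h1 x + (h2 x)^*)]].

(* An operator on the subspace represented by [X] is a map on representatives
   which is compatible with a.e. equality; its values outside [X] are
   irrelevant. *)
Record projection X (P : (T -> R[i]) -> T -> R[i]) : Prop := Projection {
  projection_sub : forall f, X f -> X (P f) ;
  projection_ae : forall f g,
    X f -> X g -> f = g %[ae mu] -> P f = P g %[ae mu] ;
  projectionD : forall f g, X f -> X g -> P (f \+ g) = P f \+ P g %[ae mu] ;
  projectionZ : forall (c : R[i]) f, X f ->
    P (fun x => c * f x) = (fun x => c * P f x) %[ae mu] ;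
  projection_idem : forall f, X f -> P (P f) = P f %[ae mu] ;
  projection_neq0 : exists2 f, X f & ~ (P f = cst 0 %[ae mu]) }.

Definition opnorm p X (P : (T -> R[i]) -> T -> R[i]) : \bar R :=
  ereal_sup [set CLnorm p (P f) | f in [set f | X f /\ (CLnorm p f <= 1)%E]].

Definition measurable_wrt (G : set (set T)) f : Prop :=
  preimage_set_system setT (fun x => complex.Re (f x)) measurable `<=` G /\
  preimage_set_system setT (fun x => complex.Im (f x)) measurable `<=` G.

(* Since null sets are included, the result does not depend on the choice of
   representatives of the functions in [F].  It is meant for complete [mu];
   otherwise no sub sigma-algebra contains all negligible sets. *)
Definition complete_sigma_generated (F : set (T -> R[i])) : set (set T) :=
  smallest [set G | [/\ sigma_algebra setT G, G `<=` measurable &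
                        forall f, F f -> measurable_wrt G f]]
           mu.-negligible.

(* [g] is a version of the conditional expectation E(f | G). *)
Record is_condexp (G : set (set T)) f g : Prop := IsCondexp {
  condexp_measurable : measurable_wrt G g ;
  condexp_integrable : CLp 1 g ;
  condexp_integral : forall A, G A -> Cintegral A g = Cintegral A f }.

End ComplexLp.

Arguments Linf_ball {d T R} mu.
Arguments sum_conj {d T R} mu X.

(* Main.v *)
Require Import Defs.
From mathcomp Require Import measurable_realfun ess_sup_inf zify ring lra.
Import Order.TTheory GRing.Theory Num.Theory.

(** Contractivity of [P] says that among the functions [g + c f], with [g] in
    [Ran P] and [f] in [Ker P], the one with [c = 0] has the smallest p-th
    moment. Since [p = 2k + 2] is an even integer, the moment is a polynomial
    in [c] and its conjugate, and the vanishing of its linear part reads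
      [\int f g^k conj(g)^(k+1) = 0]   ([first_variation]).
    This is again a polynomial identity in [g], which ranges over a vector
    space containing 1. Differentiating it at [g = 1], once in a holomorphic
    and twice in antiholomorphic directions, gives
      [\int f u conj(v) conj(w) = 0]   for [u], [v], [w] in [Ran P]
    ([kernel_orthogonal]); this is where [k >= 1] enters.

    For a multiplier [h] of [X] and [u] in [Ran P], both [h u - P (h u)] and
    [h - P h] lie in [Ker P], and these relations make [P (h u) - u P h]
    orthogonal to itself. Hence [P (h u) = u P h] ([range_multiplier]): [P]
    sends multipliers of [X] to multipliers of [Ran P]. The latter are bounded
    functions, because multiplication by [h] is bounded on [X]
    ([multiplier_bounded], a closed graph theorem) and so the moments of the
    powers of [P h] grow at most geometrically ([range_algebra_P]).

    Let [N] be the algebra of bounded multipliers of [Ran P]. The relations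
    say that [Ker P] annihilates the self-adjoint algebra generated by [N].
    The sets whose indicator is annihilated by every integrable function
    annihilating this algebra form a complete sigma-algebra [S]
    ([sigma_algebra_bisets]), and the functions in [N] are measurable for [S],
    because the indicator of a half-line is a bounded limit of polynomials on
    bounded intervals ([bisets_ray]). So [f - P f], which lies in [Ker P], has
    integral zero on every set in [S], and it is enough to show that [S]
    contains the sigma-algebra generated by [Ran P]; for this, every [u] in
    [Ran P] is shown to be a limit of functions [n + conj(m)] with [n], [m] in
    [N].

    Under the first hypothesis [u] is a limit of multipliers [h] of [X], hence
    of [P h], which is in [N] ([approx_of_dense]). Under the second one, [E (h
    + conj(h')) = P h + conj(P h')] does not increase quadratic means, and it
    does not change integrals against [r = u - w] when [w = n + conj(m)]. If
    [w] nearly minimizes the quadratic mean of [r], then [r] is nearly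
    orthogonal to the functions [E (h + conj(h'))], hence to [h + conj(h')]
    itself, hence by weak-star density to all bounded functions, and finally
    to itself ([weak_density_approx], [approx_of_weak_star]). *)

Set Implicit Arguments.
Unset Strict Implicit.
Unset Printing Implicit Defensive.

Local Open Scope classical_set_scope.
Local Open Scope ring_scope.
Local Open Scope complex_scope.
Local Notation "z ^*" := (conjc z) : ring_scope.

(** * The modulus of a complex number *)

(** The norm of [R[i]] is complex-valued; inequalities between moduli are stated
    in [R]. *)
Definition cmod (R : realType) (z : R[i]) : R := complex.Re `|z|.

Section Modulus.
Context {R : realType}.
Implicit Types z w : R[i].

Lemma cmodE z : cmod z = Num.sqrt (complex.Re z ^+ 2 + complex.Im z ^+ 2).
Proof. by rewrite /cmod normc_def. Qed.

Lemma normC_cmod z : `|z| = (cmod z)%:C.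
Proof. by rewrite /cmod normc_def. Qed.

Lemma cmod_ge0 z : 0 <= cmod z.
Proof. by rewrite cmodE sqrtr_ge0. Qed.

Lemma sqr_cmod z : cmod z ^+ 2 = complex.Re z ^+ 2 + complex.Im z ^+ 2.
Proof. by rewrite cmodE sqr_sqrtr// addr_ge0 ?sqr_ge0. Qed.

Lemma cmodM z w : cmod (z * w) = cmod z * cmod w.
Proof.
rewrite {1}/cmod normrM !normC_cmod -rmorphM/=.
by rewrite -?rmorphM.
Qed.

Lemma cmodD z w : cmod (z + w) <= cmod z + cmod w.
Proof. by have := ler_normD z w; rewrite !normC_cmod -rmorphD lecR. Qed.

Lemma cmod0 : cmod (0 : R[i]) = 0. Proof. by rewrite /cmod normr0. Qed.
Lemma cmod1 : cmod (1 : R[i]) = 1. Proof. by rewrite /cmod normr1. Qed.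
Lemma cmodN z : cmod (- z) = cmod z. Proof. by rewrite /cmod normrN. Qed.

Lemma cmodX z n : cmod (z ^+ n) = cmod z ^+ n.
Proof. by elim: n => [|n IH]; rewrite ?expr0 ?cmod1// !exprS cmodM IH. Qed.

Lemma cmodJ z : cmod z^* = cmod z.
Proof. by rewrite /cmod normcJ. Qed.

Lemma cmod_real (r : R) : cmod r%:C = `|r|.
Proof. by rewrite cmodE /= expr0n/= addr0 sqrtr_sqr. Qed.

Lemma cmod_eq0 z : cmod z = 0 -> z = 0.
Proof. by move=> z0; apply/eqP; rewrite -normr_eq0 normC_cmod z0. Qed.

Lemma normr_Re_le z : `|complex.Re z| <= cmod z.
Proof. by rewrite cmodE -sqrtr_sqr ler_wsqrtr// lerDl sqr_ge0. Qed.

Lemma normr_Im_le z : `|complex.Im z| <= cmod z.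
Proof. by rewrite cmodE -sqrtr_sqr ler_wsqrtr// lerDr sqr_ge0. Qed.

Lemma cmod_le z : cmod z <= `|complex.Re z| + `|complex.Im z|.
Proof.
have h : 0 <= `|complex.Re z| + `|complex.Im z| by rewrite addr_ge0.
rewrite -(@ler_pXn2r _ 2)// ?nnegrE ?cmod_ge0//.
rewrite sqr_cmod sqrrD !real_normK ?num_real// -addrA lerD2l lerDr.
by rewrite mulrn_wge0 // mulr_ge0.
Qed.

Lemma mulcJ z : z * z^* = (cmod z ^+ 2)%:C.
Proof. by rewrite -sqr_normc normC_cmod -rmorphXn. Qed.

Lemma re_mulc z w : complex.Re (z * w) =
  complex.Re z * complex.Re w - complex.Im z * complex.Im w.
Proof. by case: z => a b; case: w. Qed.
Lemma im_mulc z w : complex.Im (z * w) =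
  complex.Re z * complex.Im w + complex.Im z * complex.Re w.
Proof. by case: z => a b; case: w. Qed.
Lemma re_addc z w : complex.Re (z + w) = complex.Re z + complex.Re w.
Proof. by case: z => a b; case: w. Qed.
Lemma im_addc z w : complex.Im (z + w) = complex.Im z + complex.Im w.
Proof. by case: z => a b; case: w. Qed.
Lemma re_oppc z : complex.Re (- z) = - complex.Re z. Proof. by case: z. Qed.
Lemma im_oppc z : complex.Im (- z) = - complex.Im z. Proof. by case: z. Qed.
Lemma re_conjc z : complex.Re z^* = complex.Re z. Proof. by case: z. Qed.
Lemma im_conjc z : complex.Im z^* = - complex.Im z. Proof. by case: z. Qed.

Lemma complex_ext z w : complex.Re z = complex.Re w ->
  complex.Im z = complex.Im w -> z = w.
Proof. by case: z => a b; case: w => c d /= -> ->. Qed.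

(** Crude convexity bound: it replaces Minkowski's inequality throughout. *)
Lemma expr_cmodD q z w :
  cmod (z + w) ^+ q <= 2 ^+ q * (cmod z ^+ q + cmod w ^+ q).
Proof.
wlog le : z w / cmod z <= cmod w.
  move=> H; have [|/ltW] := leP (cmod z) (cmod w); first exact: H.
  by move=> /H; rewrite addrC [X in _ <= _ * X]addrC.
apply: (@le_trans _ _ ((2 * cmod w) ^+ q)).
  rewrite lerXn2r ?nnegrE ?mulr_ge0 ?cmod_ge0//.
  by apply: le_trans (cmodD _ _) _; rewrite mulr_natl mulr2n lerD2r.
by rewrite exprMn ler_pM2l ?exprn_gt0// lerDr exprn_ge0 ?cmod_ge0.
Qed.

End Modulus.

(** * Measurable and integrable complex functions *)

Section Integral.
Context {d : measure_display} {T : measurableType d} {R : realType}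
  (mu : probability T R).
Implicit Types (f g h : T -> R[i]) (u v : T -> R).

Local Notation intg u := (mu.-integrable setT (EFin \o u)).

Lemma Cmeasurable_cst (c : R[i]) : Cmeasurable (fun _ : T => c).
Proof. by split; exact: measurable_cst. Qed.

Lemma CmeasurableD f g :
  Cmeasurable f -> Cmeasurable g -> Cmeasurable (fun x => f x + g x).
Proof.
move=> [f1 f2] [g1 g2]; split.
  by under eq_fun do rewrite re_addc; exact: measurable_funD.
by under eq_fun do rewrite im_addc; exact: measurable_funD.
Qed.

Lemma CmeasurableM f g :
  Cmeasurable f -> Cmeasurable g -> Cmeasurable (fun x => f x * g x).
Proof.
move=> [f1 f2] [g1 g2]; split.
  by under eq_fun do rewrite re_mulc; apply: measurable_funB; exact: measurable_funM.
by under eq_fun do rewrite im_mulc; apply: measurable_funD; exact: measurable_funM.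
Qed.

Lemma CmeasurableJ f : Cmeasurable f -> Cmeasurable (fun x => (f x)^*).
Proof.
move=> [f1 f2]; split; first by under eq_fun do rewrite re_conjc.
by under eq_fun do rewrite im_conjc; exact: measurable_funN.
Qed.

Lemma CmeasurableN f : Cmeasurable f -> Cmeasurable (fun x => - f x).
Proof.
move=> [f1 f2]; split; first by under eq_fun do rewrite re_oppc; exact: measurable_funN.
by under eq_fun do rewrite im_oppc; exact: measurable_funN.
Qed.

Lemma measurable_cmod f : Cmeasurable f -> measurable_fun setT (fun x => cmod (f x)).
Proof.
move=> [f1 f2]; under eq_fun do rewrite cmodE.
apply: measurableT_comp; first exact: continuous_measurable_fun (@sqrt_continuous R).
by apply: measurable_funD; exact: measurable_funX.
Qed.

Lemma measurable_cmodX f q :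
  Cmeasurable f -> measurable_fun setT (fun x => cmod (f x) ^+ q).
Proof. by move=> mf; apply: measurable_funX; exact: measurable_cmod. Qed.

Lemma intg_dominated u v : measurable_fun setT u -> intg v ->
  (forall x, `|u x| <= v x) -> intg u.
Proof.
move=> mu' iv uv; apply: le_integrable iv => //; first exact/measurable_EFinP.
by move=> x _ /=; rewrite lee_fin (le_trans (uv x))// ler_norm.
Qed.

Lemma intgD u v : intg u -> intg v -> intg (fun x => u x + v x).
Proof. by move=> iu iv; have := integrableD measurableT iu iv. Qed.

Lemma intgB u v : intg u -> intg v -> intg (fun x => u x - v x).
Proof. by move=> iu iv; have := integrableB measurableT iu iv. Qed.

Lemma intgZ (c : R) u : intg u -> intg (fun x => c * u x).
Proof. by move=> iu; have := integrableZl measurableT c iu. Qed.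

Lemma intgN u : intg u -> intg (fun x => - u x).
Proof. by move=> iu; have := integrableN iu. Qed.

Lemma intg_cst (c : R) : intg (fun _ => c).
Proof. exact: finite_measure_integrable_cst. Qed.

Lemma intg_measurable u : intg u -> measurable_fun setT u.
Proof. by move=> /(measurable_int mu) /measurable_EFinP. Qed.

Lemma intg_norm u : intg u -> intg (fun x => `|u x|).
Proof. exact: integrable_norm. Qed.

Lemma intg_ae u v : (\forall x \ae mu, u x = v x) ->
  measurable_fun setT v -> intg u -> intg v.
Proof.
move=> uv mv /integrableP[mu' iu]; apply/integrableP; split.
  exact/measurable_EFinP.
rewrite (ae_eq_integral (fun x => `|(u x)%:E|%E))//.
- by apply: measurableT_comp => //; exact/measurable_EFinP.
- by apply: measurableT_comp => //.
- by apply: filterS uv => x /= ->.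
Qed.

Lemma ae_eq_Rintegral u v : (\forall x \ae mu, u x = v x) ->
  measurable_fun setT u -> measurable_fun setT v ->
  \int[mu]_x u x = \int[mu]_x v x.
Proof.
move=> uv mu' mv; rewrite /Rintegral; congr fine; apply: ae_eq_integral => //.
- exact/measurable_EFinP.
- exact/measurable_EFinP.
- by apply: filterS uv => x /= ->.
Qed.

Lemma le_RintegralT u v : intg u -> intg v -> (forall x, u x <= v x) ->
  \int[mu]_x u x <= \int[mu]_x v x.
Proof. by move=> iu iv uv; apply: le_Rintegral. Qed.

Lemma Rintegral_cstT (c : R) : \int[mu]_(_ in setT) c = c.
Proof.
have := @Rintegral_cst _ _ _ mu setT measurableT c.
by rewrite /= probability_setT /= mulr1.
Qed.

Lemma Rintegral_eq0_ae u : intg u -> (forall x, 0 <= u x) ->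
  \int[mu]_x u x = 0 -> \forall x \ae mu, u x = 0.
Proof.
move=> iu u0 Iu.
have /(ae_eq_integral_abs mu measurableT (measurable_int mu iu)) :
    (\int[mu]_x `|(u x)%:E| = 0)%E.
  under eq_integral do rewrite gee0_abs ?lee_fin//.
  have := integrable_fin_num measurableT iu => /fineK <-.
  by congr EFin.
by apply: filterS => x /= /(_ Logic.I) [].
Qed.

Definition Cintegrable f :=
  intg (fun x => complex.Re (f x)) /\ intg (fun x => complex.Im (f x)).

Local Notation CI f := (Cintegral mu setT f).

Lemma Cintegrable_measurable f : Cintegrable f -> Cmeasurable f.
Proof. by move=> [/intg_measurable ? /intg_measurable ?]. Qed.

Lemma Cintegrable_dominated f v : Cmeasurable f -> intg v ->
  (forall x, cmod (f x) <= v x) -> Cintegrable f.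
Proof.
move=> [f1 f2] iv fv; split; apply: intg_dominated iv _ => // x.
  exact: le_trans (normr_Re_le _) (fv x).
exact: le_trans (normr_Im_le _) (fv x).
Qed.

Lemma Cintegrable_cmod f : Cintegrable f -> intg (fun x => cmod (f x)).
Proof.
move=> fi; have mf := Cintegrable_measurable fi; case: fi => f1 f2.
apply: intg_dominated (intgD (intg_norm f1) (intg_norm f2)) _.
  exact: measurable_cmod.
by move=> x; rewrite ger0_norm ?cmod_ge0// cmod_le.
Qed.

Lemma CintegrableD f g :
  Cintegrable f -> Cintegrable g -> Cintegrable (fun x => f x + g x).
Proof.
move=> [f1 f2] [g1 g2]; split.
  by under eq_fun do rewrite re_addc; exact: intgD.
by under eq_fun do rewrite im_addc; exact: intgD.
Qed.

Lemma CintegrableZ (c : R[i]) f : Cintegrable f -> Cintegrable (fun x => c * f x).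
Proof.
move=> [f1 f2]; split.
  by under eq_fun do rewrite re_mulc; apply: intgB; exact: intgZ.
by under eq_fun do rewrite im_mulc; apply: intgD; exact: intgZ.
Qed.

Lemma CintegralD f g : Cintegrable f -> Cintegrable g ->
  CI (fun x => f x + g x) = CI f + CI g.
Proof.
move=> [f1 f2] [g1 g2]; apply: complex_ext; rewrite ?re_addc ?im_addc /=.
  by under eq_Rintegral do rewrite re_addc; rewrite RintegralD.
by under eq_Rintegral do rewrite im_addc; rewrite RintegralD.
Qed.

Lemma CintegralZ (c : R[i]) f : Cintegrable f ->
  CI (fun x => c * f x) = c * CI f.
Proof.
move=> [f1 f2]; apply: complex_ext; rewrite ?re_mulc ?im_mulc /=.
  under eq_Rintegral do rewrite re_mulc.
  by rewrite RintegralB ?RintegralZl//; exact: intgZ.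
under eq_Rintegral do rewrite im_mulc.
by rewrite RintegralD ?RintegralZl//; exact: intgZ.
Qed.

Lemma CintegralN f : Cintegrable f -> CI (fun x => - f x) = - CI f.
Proof.
move=> fi; rewrite -mulN1r -CintegralZ//; congr Cintegral.
by apply/funext => x; rewrite mulN1r.
Qed.

Lemma CintegralB f g : Cintegrable f -> Cintegrable g ->
  CI (fun x => f x - g x) = CI f - CI g.
Proof.
move=> fi gi; rewrite CintegralD// ?CintegralN//.
by have := CintegrableZ (-1) gi; under eq_fun do rewrite mulN1r.
Qed.

Lemma CintegralJ f : Cintegrable f -> CI (fun x => (f x)^*) = (CI f)^*.
Proof.
move=> [f1 f2]; apply: complex_ext; rewrite ?re_conjc ?im_conjc /=.
  by under eq_Rintegral do rewrite re_conjc.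
under eq_Rintegral do rewrite im_conjc -mulN1r.
by rewrite RintegralZl// mulN1r.
Qed.

(** The factor 2 comes from bounding the real and imaginary parts separately. *)
Lemma cmod_Cintegral_le f : Cintegrable f ->
  cmod (CI f) <= 2 * \int[mu]_x cmod (f x).
Proof.
move=> fi; have ci := Cintegrable_cmod fi; case: fi => f1 f2.
apply: le_trans (cmod_le _) _; rewrite mulr_natl mulr2n /=; apply: lerD.
  apply: le_trans (le_normr_Rintegral _ _) _ => //.
  by apply: le_RintegralT => //; [exact: intg_norm|move=> x; exact: normr_Re_le].
apply: le_trans (le_normr_Rintegral _ _) _ => //.
by apply: le_RintegralT => //; [exact: intg_norm|move=> x; exact: normr_Im_le].
Qed.

Lemma Cintegral_mulcJ f : CI (fun x => f x * (f x)^*) = (\int[mu]_x cmod (f x) ^+ 2)%:C.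
Proof.
apply: complex_ext => /=; first by under eq_Rintegral do rewrite mulcJ.
by under eq_Rintegral do rewrite mulcJ; exact: Rintegral_cstT.
Qed.

End Integral.

(** * Almost everywhere convergence *)

Section Convergence.
Context {d : measure_display} {T : measurableType d} {R : realType}
  (mu : probability T R).
Implicit Types (u v g : T -> R).

Local Notation intg u := (mu.-integrable setT (EFin \o u)).

Definition ess_bounded u := exists C : R, \forall x \ae mu, `|u x| <= C.

Lemma ess_bounded_ge0 u : ess_bounded u ->
  exists2 C : R, 0 < C & \forall x \ae mu, `|u x| <= C.
Proof.
move=> [C uC]; exists (`|C| + 1); first by rewrite ltr_pwDr.
apply: filterS uC => x /le_trans; apply.
by rewrite (le_trans (ler_norm _))// lerDl.
Qed.

(** Clamping [u] to its essential bound changes it only on a null set. *)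
Lemma intgM_ess_bounded g u : intg g -> measurable_fun setT u ->
  ess_bounded u -> intg (fun x => g x * u x).
Proof.
move=> ig mu' /ess_bounded_ge0[C C0 uC].
pose v x := Num.max (- C) (Num.min C (u x)).
have mv : measurable_fun setT v.
  by apply: measurable_maxr => //; apply: measurable_minr.
apply: (@intg_ae _ _ _ mu (fun x => g x * v x)).
- apply: filterS uC => x; rewrite ler_norml => /andP[h1 h2].
  by rewrite /v min_r// max_r.
- exact: measurable_funM (intg_measurable ig) mu'.
- apply: (@intg_dominated _ _ _ mu _ (fun x => C * `|g x|)).
  + exact: measurable_funM (intg_measurable ig) mv.
  + exact: intgZ (intg_norm ig).
  + move=> x; rewrite normrM mulrC ler_wpM2r// ler_norml /v.
    by rewrite le_max lexx/= ge_max ge_min lexx/= andbT (le_trans _ (ltW C0))// oppr_le0 ltW.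
Qed.

Lemma Rintegral_dominated_cvg (u_ : nat -> T -> R) u g :
  (forall n, measurable_fun setT (u_ n)) -> measurable_fun setT u ->
  (\forall x \ae mu, u_ ^~ x @ \oo --> u x) -> intg g ->
  (\forall x \ae mu, forall n, `|u_ n x| <= g x) ->
  \int[mu]_x u_ n x @[n --> \oo] --> \int[mu]_x u x.
Proof.
move=> mu_ mu' cu ig ug.
have [|||||iu _] := @dominated_convergence _ _ _ mu setT measurableT
  (fun n => EFin \o u_ n) (EFin \o u) (EFin \o g).
- by move=> n; exact/measurable_EFinP.
- exact/measurable_EFinP.
- apply: filterS cu => x cx _; by apply/fine_cvgP; split; [exact: nearW|exact: cx].
- exact: ig.
- by apply: filterS ug => x gx n _; rewrite lee_fin.
have := integrable_fin_num measurableT iu => fi.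
rewrite -(fineK fi) => /fine_cvg; exact.
Qed.

(** A Borel-Cantelli statement for functions: the sum has finite integral. *)
Lemma ae_summable (F : nat -> T -> R) :
  (forall n, intg (F n)) -> (forall n x, 0 <= F n x) ->
  (forall n, \int[mu]_x F n x <= (2^-1) ^+ n) ->
  \forall x \ae mu, cvgn (series (F ^~ x)).
Proof.
move=> iF F0 IF.
pose G x := (\sum_(n <oo) (F n x)%:E)%E.
have mG : measurable_fun setT G.
  apply: (@ge0_emeasurable_sum _ _ _ setT (fun n x => (F n x)%:E) xpredT).
    by move=> n x _ _; rewrite lee_fin.
  by move=> n _; exact: (measurable_int _ (iF n)).
have G0 x : (0 <= G x)%E by apply: nneseries_ge0 => n _ _; rewrite lee_fin.
have iG : mu.-integrable setT G.
  apply/integrableP; split=> //.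
  under eq_integral do rewrite gee0_abs//.
  rewrite integral_nneseries//; first last.
  - by move=> n x _; rewrite lee_fin.
  - by move=> n; exact: (measurable_int _ (iF n)).
  apply: (@le_lt_trans _ _ (\sum_(n <oo) ((2^-1) ^+ n)%:E)%E).
    apply: lee_nneseries => [n _ _|n _].
      by apply: integral_ge0 => x _; rewrite lee_fin.
    have /fineK <- := integrable_fin_num measurableT (iF n).
    by rewrite lee_fin; exact: IF.
  apply: (@le_lt_trans _ _ 2%:E); last exact: ltry.
  apply: lime_le; first by apply: is_cvg_nneseries => n _ _; rewrite lee_fin exprn_ge0.
  apply: nearW => n; rewrite sumEFin lee_fin.
  rewrite (_ : \sum_(0 <= i < n) _ = series (geometric 1 2^-1) n); last first.
    by apply: eq_bigr => i _; rewrite /= mul1r.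
  rewrite geometric_seriesE; last by rewrite lt_eqF// invf_lt1// ltr1n.
  rewrite /= mul1r; have -> : 1 - 2^-1 = 2^-1 :> R by lra.
  by rewrite invrK -[leRHS]mul1r ler_wpM2r// lerBlDr lerDl exprn_ge0.
have := integrable_ae measurableT iG.
apply: filterS => x /= /(_ Logic.I) fG.
apply: nondecreasing_is_cvgn.
  by apply/nondecreasing_seqP => n; rewrite /series/= big_nat_recr//= lerDl.
exists (fine (G x)) => _ [n _ <-]; rewrite -lee_fin fineK// /series /= -sumEFin.
by apply: nneseries_lim_ge => // i _; rewrite lee_fin.
Qed.

End Convergence.

(** * The sigma-algebra of a function algebra by double annihilation *)

Section Bicommutant.
Context {d : measure_display} {T : measurableType d} {R : realType}
  (mu : probability T R) (K : set (T -> R)).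
Implicit Types (u v g : T -> R) (A : set T).

Local Notation intg u := (mu.-integrable setT (EFin \o u)).

(** The double annihilator of [K] inside the bounded functions is the weak-star
    closed linear span of [K].  Being defined by integrals, it is stable under
    bounded almost everywhere limits. *)
Definition annihilates g := intg g /\ forall k, K k -> \int[mu]_x (g x * k x) = 0.

Definition biannihilator u := [/\ measurable_fun setT u, ess_bounded mu u &
  forall g, annihilates g -> \int[mu]_x (g x * u x) = 0].

Definition bisets A := measurable A /\ biannihilator (\1_A).

Hypothesis K_measurable : forall k, K k -> measurable_fun setT k.
Hypothesis K_bounded : forall k, K k -> ess_bounded mu k.
Hypothesis K1 : K (cst 1).
(* This holds when the span of [K] is an algebra. *)
Hypothesis K_module : forall g k, annihilates g -> K k ->
  annihilates (fun x => g x * k x).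

Lemma biannihilator_sub k : K k -> biannihilator k.
Proof.
by move=> Kk; split; [exact: K_measurable|exact: K_bounded|move=> g [_]; exact].
Qed.

Lemma biannihilatorD u v :
  biannihilator u -> biannihilator v -> biannihilator (fun x => u x + v x).
Proof.
move=> [mu' [C uC] Hu] [mv [D vD] Hv]; split; first exact: measurable_funD.
  exists (C + D); apply: filterS2 uC vD => x h1 h2.
  by rewrite (le_trans (ler_normD _ _))// lerD.
move=> g ag; have ig := ag.1.
under eq_Rintegral do rewrite mulrDr.
rewrite RintegralD ?Hu ?Hv ?addr0//; apply: intgM_ess_bounded => //.
  by exists C.
by exists D.
Qed.

Lemma biannihilatorZ (c : R) u :
  biannihilator u -> biannihilator (fun x => c * u x).
Proof.
move=> [mu' [C uC] Hu]; split; first exact: measurable_funM.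
  exists (`|c| * C); apply: filterS uC => x h.
  by rewrite normrM ler_wpM2l.
move=> g ag; have ig := ag.1.
under eq_Rintegral do rewrite mulrCA.
by rewrite RintegralZl ?Hu ?mulr0//; apply: intgM_ess_bounded => //; exists C.
Qed.

Lemma biannihilator_cst (c : R) : biannihilator (fun _ => c).
Proof.
have := biannihilatorZ c (biannihilator_sub K1).
by under eq_fun do rewrite mulr1.
Qed.

(** Moving one factor at a time across the annihilation relation, first by the
    module hypothesis and then by the definition, gives closure under
    products. *)
Lemma biannihilatorM u v :
  biannihilator u -> biannihilator v -> biannihilator (fun x => u x * v x).
Proof.
move=> [mu' bu Hu] [mv bv Hv]; split; first exact: measurable_funM.
  have [C C0 uC] := ess_bounded_ge0 bu; have [D _ vD] := ess_bounded_ge0 bv.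
  exists (C * D); apply: filterS2 uC vD => x h1 h2.
  by rewrite normrM ler_pM.
move=> g ag; have ig := ag.1.
under eq_Rintegral do rewrite mulrA.
apply: Hv; split; first exact: intgM_ess_bounded.
move=> k Kk; under eq_Rintegral do rewrite mulrAC.
exact: Hu (K_module ag Kk).
Qed.

Lemma biannihilator_cvg (u_ : nat -> T -> R) u (C : R) :
  (forall n, biannihilator (u_ n)) -> measurable_fun setT u ->
  (\forall x \ae mu, forall n, `|u_ n x| <= C) ->
  (\forall x \ae mu, u_ ^~ x @ \oo --> u x) -> biannihilator u.
Proof.
move=> Hu_ mu' uC cu; split=> //.
  exists C; apply: filterS2 uC cu => x xC cx.
  have cn : `|u_ n x| @[n --> \oo] --> `|u x| by exact: cvg_norm.
  rewrite -(cvg_lim _ cn)//; apply: limr_le; first by apply/cvg_ex; eexists; exact: cn.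
  exact: nearW.
move=> g ag; have ig := ag.1.
have h : \int[mu]_x (g x * u_ n x) @[n --> \oo] --> \int[mu]_x (g x * u x).
  apply: (@Rintegral_dominated_cvg _ _ _ _ _ _ (fun x => C * `|g x|)).
  - by move=> n; apply: measurable_funM; [exact: intg_measurable ig|case: (Hu_ n)].
  - by apply: measurable_funM; [exact: intg_measurable ig|].
  - by apply: filterS cu => x cx; apply: cvgM; [exact: cvg_cst|].
  - by apply: intgZ; exact: intg_norm.
  - apply: filterS uC => x xC n; rewrite normrM mulrC.
    by rewrite ler_wpM2r.
rewrite -(cvg_lim _ h)//.
rewrite (_ : (fun n => _) = fun=> 0); first exact: lim_cst.
by apply/funext => n; have [_ _] := Hu_ n; apply.
Qed.

Lemma biannihilator_ae u v : biannihilator u -> measurable_fun setT v ->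
  (\forall x \ae mu, u x = v x) -> biannihilator v.
Proof.
move=> Hu mv uv; have [mu' [C uC] _] := Hu.
apply: (@biannihilator_cvg (fun=> u) v C) => //.
  by apply: filterS uC => x.
by apply: filterS uv => x ->; exact: cvg_cst.
Qed.

Lemma bisetsC A : bisets A -> bisets (~` A).
Proof.
move=> [mA HA]; split; first exact: measurableC.
have := biannihilatorD (biannihilator_cst 1) (biannihilatorZ (-1) HA).
congr biannihilator; apply/funext => x; rewrite !indicE in_setC.
by case: (x \in A) => /=; rewrite ?mulr1 ?mulr0 ?subrr ?addr0.
Qed.

Lemma bisetsI A B : bisets A -> bisets B -> bisets (A `&` B).
Proof.
move=> [mA HA] [mB HB]; split; first exact: measurableI.
have := biannihilatorM HA HB.
congr biannihilator; apply/funext => x; rewrite !indicE in_setI.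
by case: (x \in A); case: (x \in B); rewrite /= ?mulr1 ?mulr0.
Qed.

Lemma bisets0 : bisets set0.
Proof. by split=> //; rewrite indic0; exact: biannihilator_cst. Qed.

Lemma bisets_bigcup (F : (set T)^nat) :
  (forall n, bisets (F n)) -> bisets (\bigcup_n F n).
Proof.
move=> HF.
have HU n : bisets (\big[setU/set0]_(i < n) F i).
  elim: n => [|n IH]; first by rewrite big_ord0; exact: bisets0.
  rewrite big_ord_recr /= -[X in bisets X]setCK setCU; apply: bisetsC.
  by apply: bisetsI; exact: bisetsC.
have mU : measurable (\bigcup_n F n) by apply: bigcup_measurable => n _; case: (HF n).
split=> //.
apply: (@biannihilator_cvg (fun n => \1_(\big[setU/set0]_(i < n) F i)) _ 1).
- by move=> n; case: (HU n).
- exact: measurable_indic.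
- apply: aeW => x n; rewrite indicE; case: (x \in _); rewrite ?normr1 ?normr0//.
- apply: aeW => x; apply: cvg_near_cst.
  have [[i _ Fix]|nF] := pselect ((\bigcup_n F n) x).
    exists i.+1 => // n /= ni; rewrite !indicE !mem_set//; first by exists i.
    by rewrite -bigcup_mkord; exists i.
  near=> n; rewrite !indicE !memNset//.
  by rewrite -bigcup_mkord => -[i _ Fix]; apply: nF; exists i.
Unshelve. all: by end_near. Qed.

Lemma sigma_algebra_bisets : sigma_algebra setT bisets.
Proof.
split; [exact: bisets0| |exact: bisets_bigcup].
by move=> A HA; rewrite setTD; exact: bisetsC.
Qed.

Lemma bisets_negligible : measure_is_complete mu -> mu.-negligible `<=` bisets.
Proof.
move=> cmu A nA; have mA := cmu _ nA; split=> //.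
apply: (biannihilator_ae (biannihilator_cst 0)); first exact: measurable_indic.
have [N [mN N0 AN]] := nA; exists N; split=> // x /= h.
apply: AN; apply: contrapT => Ax; apply: h.
by rewrite indicE memNset.
Qed.

(** The cubic [(3t - t^3)/2] maps [-1,1] to itself and its iterates converge to the
    sign function there, which makes the sign a limit of polynomials. *)
Definition sign_step (t : R) := (3 * t - t ^+ 3) / 2.

Lemma sign_step_itv t : 0 <= t <= 1 -> t <= sign_step t <= 1.
Proof.
move=> /andP[t0 t1]; rewrite /sign_step ler_pdivlMr// ler_pdivrMr//.
have h2 : t ^+ 2 <= 1 by rewrite expr_le1.
have h3 : t ^+ 3 = t * t ^+ 2 by rewrite exprS.
apply/andP; split; first by rewrite h3; nra.
have : 0 <= (1 - t) ^+ 2 * (2 + t) by rewrite mulr_ge0 ?sqr_ge0//; lra.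
by rewrite !expr2 in h2 h3 *; nra.
Qed.

Lemma iter_sign_step_itv t n : 0 <= t <= 1 -> t <= iter n sign_step t <= 1.
Proof.
move=> t01; elim: n => [|n /andP[h1 h2]] /=.
  by case/andP: t01 => _ ->; rewrite lexx.
have t0 : 0 <= t by case/andP: t01.
have /andP[h3 ->] := @sign_step_itv (iter n sign_step t)
  (introT andP (conj (le_trans t0 h1) h2)).
by rewrite (le_trans h1 h3).
Qed.

Lemma iter_sign_stepN t n : iter n sign_step (- t) = - iter n sign_step t.
Proof. by elim: n => [|n IH]//=; rewrite IH /sign_step; field. Qed.

Lemma cvg_iter_sign_step_gt0 t : 0 < t <= 1 ->
  iter n sign_step t @[n --> \oo] --> (1 : R).
Proof.
move=> /andP[t0 t1]; have t01 : 0 <= t <= 1 by rewrite (ltW t0).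
have q0 : 0 <= 1 - t / 2 by lra.
(* 1 - s(t) = (1 - t) * ((1 - t) * (2 + t) / 2): the gap to 1 contracts *)
have bd n : `|1 - iter n sign_step t| <= geometric 1 (1 - t / 2) n.
  rewrite /= mul1r; elim: n => [|n IH].
    by rewrite expr0 /= ger0_norm; lra.
  have /andP[a1 a2] := iter_sign_step_itv n t01.
  have /andP[_ b2] := iter_sign_step_itv n.+1 t01.
  move: IH b2; rewrite /= exprS; set s := iter n _ _ in a1 a2 *.
  move=> IH b2; rewrite ger0_norm ?subr_ge0// in IH; rewrite ger0_norm ?subr_ge0//.
  have -> : 1 - sign_step s = (1 - s) * ((1 - s) * (2 + s) / 2).
    by rewrite /sign_step; field.
  rewrite [leRHS]mulrC ler_pM//; first by lra.
    by rewrite divr_ge0// mulr_ge0//; lra.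
  by nra.
apply/cvgrPdist_le => e e0.
have := @cvg_geometric R 1 (1 - t / 2).
rewrite ger0_norm// => /(_ _)/cvgr0Pnorm_le-/(_ _ e e0).
have h : 1 - t / 2 < 1 by lra.
move=> /(_ h); apply: filterS => n; apply: le_trans.
by rewrite (le_trans (bd n))// ler_norm.
Qed.

Lemma biannihilator_iter_sign_step u n :
  biannihilator u -> biannihilator (fun x => iter n sign_step (u x)).
Proof.
move=> Hu; elim: n => [|n IH] //=.
have := biannihilatorD (biannihilatorZ (3 / 2) IH)
  (biannihilatorZ (- 2^-1) (biannihilatorM IH (biannihilatorM IH IH))).
by congr biannihilator; apply/funext => x; rewrite /sign_step; field.
Qed.

(** After an affine change of [u], the indicator of [a < u] is [(s + s^2) / 2] with
    [s] the sign function. *)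
Lemma bisets_ray u a : biannihilator u -> bisets [set x | a < u x].
Proof.
move=> Hu; have mu' : measurable_fun setT u by case: Hu.
have mA : measurable [set x | a < u x].
  have -> : [set x | a < u x] = u @^-1` `]a, +oo[.
    by apply/seteqP; split=> x /=; rewrite in_itv/= andbT.
  by rewrite -[X in measurable X]setTI; exact: mu'.
split=> //.
have Hd : biannihilator (fun x => u x + - a).
  exact: biannihilatorD Hu (biannihilator_cst _).
have [C C0 uC] : exists2 C, 0 < C & \forall x \ae mu, `|u x + - a| <= C.
  by apply: ess_bounded_ge0; case: Hd.
pose y x := C^-1 * (u x + - a).
have Hy : biannihilator y by exact: biannihilatorZ.
pose s n x := iter n sign_step (y x).
have Hs n : biannihilator (s n) by exact: biannihilator_iter_sign_step.
have y1 : \forall x \ae mu, `|y x| <= 1.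
  apply: filterS uC => x xC; rewrite /y normrM ger0_norm ?invr_ge0 ?(ltW C0)//.
  by rewrite mulrC ler_pdivrMr// mul1r.
have ypos x : (0 < y x) = (a < u x) by rewrite /y pmulr_rgt0 ?invr_gt0// subr_gt0.
have s1 : \forall x \ae mu, forall n, `|s n x| <= 1.
  apply: filterS y1 => x xy n; have [y0|y0] := leP 0 (y x).
    move: xy; rewrite ger0_norm// => xy.
    have /andP[h1 h2] := @iter_sign_step_itv (y x) n (introT andP (conj y0 xy)).
    by rewrite ger0_norm// (le_trans y0).
  move: xy; rewrite ltr0_norm// => xy; rewrite -normrN /s -iter_sign_stepN.
  have ny0 : 0 <= - y x by rewrite oppr_ge0 ltW.
  have /andP[h1 h2] := @iter_sign_step_itv (- y x) n (introT andP (conj ny0 xy)).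
  by rewrite ger0_norm// (le_trans ny0).
apply: (@biannihilator_cvg (fun n x => 2^-1 * (s n x * s n x + s n x)) _ 1).
- by move=> n; apply: biannihilatorZ; apply: biannihilatorD => //; exact: biannihilatorM.
- exact: measurable_indic.
- apply: filterS s1 => x xs n; have := xs n; rewrite !ler_norml => /andP[h1 h2].
  by apply/andP; split; nra.
- apply: filterS y1 => x xy.
  have [y0|y0|y0] := ltgtP 0 (y x).
  + have -> : \1_[set x0 | a < u x0] x = 2^-1 * (1 * 1 + 1) :> R.
      by rewrite indicE mem_set/= -?ypos// mul1r -mulr2n -[X in _ * X]mulr_natl mulr1 mulVf.
    have cs : s ^~ x @ \oo --> (1 : R).
      by apply: cvg_iter_sign_step_gt0; rewrite y0 (le_trans (ler_norm _)).
    by apply: cvgMr; apply: cvgD => //; exact: cvgM.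
  + have -> : \1_[set x0 | a < u x0] x = 2^-1 * (- 1 * - 1 + - 1) :> R.
      rewrite indicE memNset ?mulrNN ?mul1r ?subrr ?mulr0//=.
      by rewrite -ypos lt_gtF.
    have cs : s ^~ x @ \oo --> (- 1 : R).
      rewrite /s; under eq_fun do rewrite -[y x]opprK iter_sign_stepN.
      apply: cvgN; apply: cvg_iter_sign_step_gt0.
      by rewrite oppr_gt0 y0/= (le_trans (ler_norm _))// normrN.
    by apply: cvgMr; apply: cvgD => //; exact: cvgM.
  + have -> : \1_[set x0 | a < u x0] x = 0 :> R.
      by rewrite indicE memNset//= -ypos y0 ltxx.
    apply: cvg_near_cst; apply: nearW => n /=.
    have -> : s n x = 0.
      rewrite /s -y0; elim: n => //= n ->; rewrite /sign_step.
      by rewrite expr0n /= mulr0 subrr mul0r.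
    by rewrite mulr0 addr0 mulr0.
Qed.

End Bicommutant.

(** * Measurability with respect to a complete sub-sigma-algebra *)

Section SubSigmaAlgebra.
Context {d : measure_display} {T : measurableType d} {R : realType}
  (mu : probability T R) (G : set (set T)).
Hypothesis sG : sigma_algebra setT G.
Hypothesis G_negligible : mu.-negligible `<=` G.
Implicit Types (u v : T -> R).

Local Notation intg u := (mu.-integrable setT (EFin \o u)).

Definition submeasurable u :=
  measurable_fun (setT : set (g_sigma_algebraType G)) (u : g_sigma_algebraType G -> R).

Lemma submeasurableP u :
  submeasurable u <-> preimage_set_system setT u measurable `<=` G.
Proof.
split=> [mu' A [B mB <-]|h].
  by have := mu' measurableT B mB; rewrite measurable_g_measurableTypeE.
move=> _ B mB; rewrite measurable_g_measurableTypeE//; apply: h.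
by exists B.
Qed.

Lemma submeasurable_rays u : (forall a, G [set x | a < u x]) -> submeasurable u.
Proof.
move=> h; rewrite /submeasurable.
apply: (measurability _ (RGenOInfty.measurableE R)).
move=> _ [_ [a ->] <-]; rewrite measurable_g_measurableTypeE// setTI.
have <- // : [set x | a < u x] = u @^-1` `]a, +oo[.
by apply/seteqP; split=> x /=; rewrite in_itv/= andbT.
Qed.

(** Off a null set [N] the limit is pointwise everywhere; [G] contains all subsets of
    [N], so the values on [N] do not matter. *)
Lemma submeasurable_ae_cvg (w_ : nat -> T -> R) u :
  (forall n, submeasurable (w_ n)) ->
  (\forall x \ae mu, w_ ^~ x @ \oo --> u x) -> submeasurable u.
Proof.
move=> mw [N [mN N0 sN]].
have GN A : A `<=` N -> G A by move=> AN; apply: G_negligible; exists N.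
have GC A : G A -> G (~` A) by case: sG => _ + _ => /[apply]; rewrite setTD.
have GU A B : G A -> G B -> G (A `|` B).
  move=> GA GB; rewrite -bigcup2E; have [_ _] := sG; apply.
  by case=> [|[|]]//= n; case: sG.
have mC : submeasurable (\1_(~` N)).
  have mNC : measurable (~` N : set (g_sigma_algebraType G)).
    by rewrite measurable_g_measurableTypeE//; exact/GC/GN.
  exact: (@measurable_indic _ (g_sigma_algebraType G) R setT (~` N) mNC).
have : submeasurable (fun x => u x * \1_(~` N) x).
  apply: (@measurable_fun_cvg _ (g_sigma_algebraType G) R setT
    (fun n x => w_ n x * \1_(~` N) x)).
    by move=> n; apply: (@measurable_funM _ (g_sigma_algebraType G) R setT) => //; exact: mw.
  move=> x _; have [Nx|Nx] := pselect (N x).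
    by rewrite indicE memNset ?mulr0//; apply: cvg_near_cst; apply: nearW => n; rewrite mulr0.
  rewrite indicE mem_set ?mulr1//; under eq_fun do rewrite mulr1.
  by apply: contrapT => ncv; apply: Nx; exact: sN.
move=> /submeasurableP h; apply/submeasurableP => _ [B mB <-].
set v := (fun x => _) in h.
have -> : setT `&` u @^-1` B = (u @^-1` B `&` N) `|` ~` (~` (v @^-1` B) `|` N).
  rewrite setCU setCK; apply/seteqP; split=> [x [_ /= Bx]|x /= [[//]|[Bx Nx]]].
    have [Nx|Nx] := pselect (N x); first by left.
    by right; split=> //; rewrite /v indicE mem_set ?mulr1.
  by split=> //; move: Bx; rewrite /v indicE mem_set ?mulr1.
apply: (GU); first by apply: GN => x [].
apply: (GC); apply: (GU); last exact: GN.
by apply: (GC); apply: h; exists B => //; rewrite setTI.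
Qed.

(** Approximations with errors [2^-n] in the mean converge almost everywhere. *)
Lemma submeasurable_approx q u : (0 < q)%N ->
  (forall e : R, 0 < e -> exists w, [/\ submeasurable w,
     intg (fun x => `|w x - u x| ^+ q) & \int[mu]_x `|w x - u x| ^+ q < e]) ->
  submeasurable u.
Proof.
move=> q0 h.
have /choice[w_ Hw] n : exists w, [/\ submeasurable w,
     intg (fun x => `|w x - u x| ^+ q) & \int[mu]_x `|w x - u x| ^+ q < 2^-1 ^+ n].
  by apply: h; rewrite exprn_gt0// invr_gt0.
apply: (submeasurable_ae_cvg (w_ := w_)); first by move=> n; case: (Hw n).
have : \forall x \ae mu, cvgn (series (fun n => `|w_ n x - u x| ^+ q)).
  apply: (@ae_summable _ _ _ mu (fun n x => `|w_ n x - u x| ^+ q)) => [n|n x|n].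
  - by case: (Hw n).
  - by rewrite exprn_ge0.
  - by case: (Hw n) => _ _ /ltW.
apply: filterS => x /cvg_series_cvg_0 c0.
apply/cvgrPdist_lt => e e0; move/cvgr0Pnorm_lt: c0 => /(_ (e ^+ q)).
rewrite exprn_gt0// => /(_ isT); apply: filterS => n.
rewrite ger0_norm ?exprn_ge0// ltr_pXn2r ?nnegrE ?(ltW e0)//.
by rewrite distrC.
Qed.

End SubSigmaAlgebra.

(** * Moments of integer order and completeness *)

Section Moments.
Context {d : measure_display} {T : measurableType d} {R : realType}
  (mu : probability T R) (q : nat).
Hypothesis q_gt0 : (0 < q)%N.
Implicit Types (f g h : T -> R[i]) (u v : T -> R).

Local Notation intg u := (mu.-integrable setT (EFin \o u)).

(** The exponent is an integer, so the moment is used instead of its root, the norm: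
    moments are polynomial in the function, and a bound [2 ^+ q] replaces the
    triangle inequality. *)
Definition moment f : R := \int[mu]_x cmod (f x) ^+ q.

Definition Lpow f := Cmeasurable f /\ intg (fun x => cmod (f x) ^+ q).

Lemma moment_ge0 f : 0 <= moment f.
Proof. by apply: Rintegral_ge0 => x _; rewrite exprn_ge0 ?cmod_ge0. Qed.

Lemma Lpow_dominated f v : Cmeasurable f -> intg v ->
  (forall x, cmod (f x) ^+ q <= v x) -> Lpow f.
Proof.
move=> mf iv fv; split=> //; apply: intg_dominated iv _; first exact: measurable_cmodX.
by move=> x; rewrite ger0_norm// exprn_ge0// cmod_ge0.
Qed.

Lemma LpowD f g : Lpow f -> Lpow g -> Lpow (fun x => f x + g x).
Proof.
move=> [mf jf] [mg jg].
apply: (@Lpow_dominated _ (fun x => 2 ^+ q * (cmod (f x) ^+ q + cmod (g x) ^+ q))).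
- exact: CmeasurableD.
- exact/intgZ/intgD.
- by move=> x; exact: expr_cmodD.
Qed.

Lemma LpowZ (c : R[i]) f : Lpow f -> Lpow (fun x => c * f x).
Proof.
move=> [mf jf].
apply: (@Lpow_dominated _ (fun x => cmod c ^+ q * cmod (f x) ^+ q)).
- by apply: CmeasurableM => //; exact: Cmeasurable_cst.
- exact: intgZ.
- by move=> x; rewrite cmodM exprMn.
Qed.

Lemma LpowJ f : Lpow f -> Lpow (fun x => (f x)^*).
Proof.
move=> [mf jf]; split; first exact: CmeasurableJ.
by under eq_fun do rewrite cmodJ.
Qed.

Lemma LpowN f : Lpow f -> Lpow (fun x => - f x).
Proof.
move=> [mf jf]; split; first exact: CmeasurableN.
by under eq_fun do rewrite cmodN.
Qed.

Lemma LpowB f g : Lpow f -> Lpow g -> Lpow (fun x => f x - g x).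
Proof. by move=> hf hg; apply: LpowD hf (LpowN hg). Qed.

Lemma Lpow_cst (c : R[i]) : Lpow (fun _ => c).
Proof. by split; [exact: Cmeasurable_cst|exact: intg_cst]. Qed.

Lemma Lpow_bounded f (C : R) : Cmeasurable f -> (\forall x \ae mu, cmod (f x) <= C) ->
  Lpow f.
Proof.
move=> mf fC; split=> //.
have -> : (fun x => cmod (f x) ^+ q) = (fun x => 1 * cmod (f x) ^+ q).
  by apply/funext => x; rewrite mul1r.
apply: intgM_ess_bounded; first exact: intg_cst.
  exact: measurable_cmodX.
exists (C ^+ q); apply: filterS fC => x xC.
rewrite ger0_norm ?exprn_ge0 ?cmod_ge0// lerXn2r// ?nnegrE ?cmod_ge0//.
exact: le_trans (cmod_ge0 _) xC.
Qed.

Lemma momentD f g : Lpow f -> Lpow g ->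
  moment (fun x => f x + g x) <= 2 ^+ q * (moment f + moment g).
Proof.
move=> hf hg; rewrite /moment -RintegralD//; [|by case: hf|by case: hg].
rewrite -RintegralZl//; last by apply: intgD; [case: hf|case: hg].
apply: le_RintegralT; first by case: (LpowD hf hg).
  by apply/intgZ/intgD; [case: hf|case: hg].
by move=> x; exact: expr_cmodD.
Qed.

Lemma momentZ (c : R[i]) f : Lpow f ->
  moment (fun x => c * f x) = cmod c ^+ q * moment f.
Proof.
move=> [mf jf]; rewrite /moment -RintegralZl//.
by apply: eq_Rintegral => x _; rewrite cmodM exprMn.
Qed.

Lemma momentN f : moment (fun x => - f x) = moment f.
Proof. by rewrite /moment; under eq_Rintegral do rewrite cmodN. Qed.

Lemma moment_ae f g : (\forall x \ae mu, f x = g x) ->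
  Cmeasurable f -> Cmeasurable g -> moment f = moment g.
Proof.
move=> fg mf mg; apply: ae_eq_Rintegral; [|exact: measurable_cmodX..].
by apply: filterS fg => x ->.
Qed.

Lemma integral_powR_moment f : Cmeasurable f ->
  (\int[mu]_x (`|(complex.Re `|f x|)%:E| `^ q%:R) = \int[mu]_x (cmod (f x) ^+ q)%:E)%E.
Proof.
move=> mf; apply: eq_integral => x _.
by rewrite abse_EFin poweR_EFin powR_mulrn// ger0_norm// cmod_ge0.
Qed.

Lemma CLp_Lpow f : CLp mu q%:R%:E f <-> Lpow f.
Proof.
have q0 : q%:R != 0 :> R by rewrite pnatr_eq0 -lt0n.
split=> [[mf]|[mf jf]].
  rewrite /CLnorm => h; split=> //; apply/integrableP; split.
    by apply/measurable_EFinP; exact: measurable_cmodX.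
  under eq_integral do rewrite gee0_abs ?lee_fin ?exprn_ge0 ?cmod_ge0//.
  rewrite -integral_powR_moment// -poweR_Lnorm//.
  exact: poweR_lty.
split=> //; rewrite /CLnorm unlock integral_powR_moment// poweR_lty//.
exact: integrable_lty jf.
Qed.

Lemma CLnorm_moment f : Lpow f ->
  CLnorm mu q%:R%:E f = (moment f `^ q%:R^-1)%:E.
Proof.
move=> [mf jf]; rewrite /CLnorm unlock integral_powR_moment//.
by rewrite -(fineK (integrable_fin_num measurableT jf)) poweR_EFin.
Qed.

Lemma powR_root (x : R) : 0 <= x -> (x `^ q%:R^-1) ^+ q = x.
Proof.
move=> x0; rewrite -powR_mulrn ?powR_ge0// -powRrM mulVf ?powRr1//.
by rewrite pnatr_eq0 -lt0n.
Qed.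

Lemma CLnorm_lt f (e : R) : Lpow f -> 0 < e ->
  (CLnorm mu q%:R%:E f < e%:E)%E <-> moment f < e ^+ q.
Proof.
move=> hf e0; rewrite CLnorm_moment// lte_fin -[X in _ <-> X < _]powR_root ?moment_ge0//.
by rewrite ltr_pXn2r// ?nnegrE ?powR_ge0 ?(ltW e0).
Qed.

Lemma CLnorm_le1 f : Lpow f -> (CLnorm mu q%:R%:E f <= 1)%E <-> moment f <= 1.
Proof.
move=> hf; rewrite CLnorm_moment// lee_fin -[X in _ <-> X <= _]powR_root ?moment_ge0//.
by rewrite -[X in _ <-> _ <= X](expr1n _ q) ler_pXn2r// ?nnegrE ?powR_ge0.
Qed.

Lemma Rintegral_fatou (u_ : nat -> T -> R) u (C : R) :
  (forall n, intg (u_ n)) -> (forall n x, 0 <= u_ n x) ->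
  measurable_fun setT u -> (forall x, u_ ^~ x @ \oo --> u x) ->
  (forall n, \int[mu]_x u_ n x <= C) ->
  intg u /\ \int[mu]_x u x <= C.
Proof.
move=> iu_ u_0 mu' cu uC.
have u0 x : 0 <= u x.
  rewrite -(cvg_lim _ (cu x))//; apply: limr_ge; first by apply/cvg_ex; eexists; exact: cu.
  exact: nearW.
have h : (\int[mu]_x (u x)%:E <= C%:E)%E.
  have f0 n x : setT x -> (0 <= (EFin \o u_ n) x)%E by rewrite lee_fin.
  have hf := @fatou _ _ _ mu setT measurableT (fun n => EFin \o u_ n)
    (fun n => measurable_int _ (iu_ n)) f0.
  have -> : (\int[mu]_x (u x)%:E =
      \int[mu]_x limn_einf (fun n => (EFin \o u_ n) x))%E.
    apply: eq_integral => x _.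
    have c : (fun n => (u_ n x)%:E) @ \oo --> (u x)%:E.
      by apply/fine_cvgP; split; [exact: nearW|exact: cu].
    rewrite is_cvg_limn_einfE; last by apply/cvg_ex; eexists; exact: c.
    by apply/esym/cvg_lim.
  apply: le_trans hf _.
  rewrite limn_einf_lim; apply: lime_le; first exact: is_cvg_einfs.
  apply: nearW => n; apply: (@le_trans _ _ (\int[mu]_x (EFin \o u_ n) x)%E).
    by apply: ereal_inf_lbound; exists n => /=.
  by rewrite -(fineK (integrable_fin_num measurableT (iu_ n))) lee_fin; exact: uC.
have iu : intg u.
  apply/integrableP; split; first exact/measurable_EFinP.
  under eq_integral do rewrite gee0_abs ?lee_fin//.
  exact: le_lt_trans h (ltry _).
by split=> //; rewrite -lee_fin /Rintegral fineK//; exact: integrable_fin_num.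
Qed.

End Moments.

Section Completeness.
Context {d : measure_display} {T : measurableType d} {R : realType}
  (mu : probability T R) (q : nat).
Hypothesis q_gt0 : (0 < q)%N.
Implicit Types (f g h : T -> R[i]) (u v : T -> R).

Local Notation intg u := (mu.-integrable setT (EFin \o u)).
Local Notation moment := (moment mu q).
Local Notation Lpow := (Lpow mu q).

Lemma series_cvg_of_pow (a : nat -> R) :
  cvgn (series (fun n => (2 ^+ n) ^+ q * `|a n| ^+ q)) -> cvgn (series a).
Proof.
move=> /cvg_series_cvg_0 c0.
have [C [_ hC]] := cvg_seq_bounded (cvgP _ c0).
have aC n : `|a n| <= geometric (`|C| + 2) 2^-1 n.
  have C1 : 1 <= `|C| + 2 by rewrite -[leLHS]add0r lerD// ler1n.
  rewrite /= exprVn ler_pdivlMr ?exprn_gt0// mulrC.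
  rewrite -(@ler_pXn2r _ q)// ?nnegrE ?mulr_ge0 ?exprn_ge0// ?(le_trans _ C1)//.
  rewrite exprMn; have := hC (`|C| + 1).
  rewrite ltr_pwDr ?ler_norm// => /(_ isT n Logic.I) /=.
  rewrite ger0_norm ?mulr_ge0 ?exprn_ge0// => /le_trans; apply.
  by apply: le_trans (ler_eXnr q_gt0 C1); rewrite lerD2l ler1n.
apply: normed_cvg; apply: (series_le_cvg _ _ aC) => [n|n|].
- exact: normr_ge0.
- exact: le_trans (normr_ge0 _) (aC n).
- by apply: is_cvg_geometric_series; rewrite ger0_norm// invf_lt1// ltr1n.
Qed.

(** The Riesz-Fischer theorem, for sequences whose increments decay so fast that the
    weights [2 ^+ q] lost at each use of [momentD] still sum up.  The limit exists
    pointwise by [ae_summable], and Fatou's lemma gives the error bound. *)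
Lemma Lpow_complete (S : nat -> T -> R[i]) (D : nat -> R) :
  (forall n, Lpow (S n)) -> (forall n, 0 < D n) -> D 0%N <= 1 ->
  (forall n, 2 ^+ q.+1 * D n.+1 <= D n) ->
  (forall n, moment (fun x => S n.+1 x - S n x) <= D n) ->
  exists2 g, Lpow g & forall n, moment (fun x => g x - S n x) <= 2 ^+ q.+1 * D n.
Proof.
move=> LS D0 D1 DS SD.
have Lsub n m : Lpow (fun x => S n x - S m x) by apply: LpowB.
have Dn n : (2 ^+ n) ^+ q * D n <= 2^-1 ^+ n.
  elim: n => [|n IH]; first by rewrite !expr0 expr1n mul1r.
  rewrite exprS exprMn [leRHS]exprS; move: IH (DS n); rewrite exprS.
  set a := (2 ^+ n) ^+ q; set b := 2 ^+ q; set c := _ ^+ n.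
  have a0 : 0 < a by rewrite exprn_gt0.
  move=> h1 h2.
  have : a * (2 * b * D n.+1) <= c by apply: le_trans h1; rewrite ler_pM2l.
  lra.
(* the tails are controlled by their first term because the bounds decay fast *)
have tail j n : moment (fun x => S (n + j)%N x - S n x) <= 2 ^+ q.+1 * D n.
  elim: j n => [|j IH] n.
    rewrite addn0 /moment; under eq_Rintegral do rewrite subrr cmod0 expr0n eqn0Ngt q_gt0.
    by rewrite Rintegral_cstT mulr_ge0 ?ltW.
  have -> : (fun x => S (n + j.+1)%N x - S n x) =
      (fun x => (S n.+1 x - S n x) + (S (n.+1 + j)%N x - S n.+1 x)).
    by apply/funext => x; rewrite addSnnS; ring.
  apply: le_trans (momentD _ _) _ => //.
  rewrite [X in _ <= X * _]exprS -mulrA mulrCA ler_pM2l// mulr_natl mulr2n lerD//.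
  exact: le_trans (IH n.+1) (DS n).
have : \forall x \ae mu, cvgn (series (fun n => (2 ^+ n) ^+ q * cmod (S n.+1 x - S n x) ^+ q)).
  apply: (@ae_summable _ _ _ mu (fun n x => (2 ^+ n) ^+ q * cmod (S n.+1 x - S n x) ^+ q)).
  - by move=> n; apply: intgZ; case: (Lsub n.+1 n).
  - by move=> n x; rewrite mulr_ge0 ?exprn_ge0 ?cmod_ge0.
  - move=> n; rewrite RintegralZl//; last by case: (Lsub n.+1 n).
    by apply: le_trans (Dn n); rewrite ler_pM2l ?exprn_gt0//; exact: SD.
move=> [N [mN N0 sN]].
have scvg x (p : R[i] -> R) : {morph p : z w / z - w} -> (forall z, `|p z| <= cmod z) ->
    ~ N x -> cvgn (fun n => p (S n x)).
  move=> pB pl Nx.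
  have cx : cvgn (series (fun n => (2 ^+ n) ^+ q * cmod (S n.+1 x - S n x) ^+ q)).
    by apply: contrapT => nc; apply: Nx; exact: sN.
  have : cvgn (series (fun n => p (S n.+1 x - S n x))).
    apply: series_cvg_of_pow; apply: series_le_cvg cx => n.
    - by rewrite mulr_ge0 ?exprn_ge0.
    - by rewrite mulr_ge0 ?exprn_ge0 ?cmod_ge0.
    - by rewrite ler_pM2l ?exprn_gt0// lerXn2r ?nnegrE ?cmod_ge0.
  have -> : (fun n => p (S n x)) =
      (fun n => p (S 0%N x) + series (fun n => p (S n.+1 x - S n x)) n).
    apply/funext => n; rewrite /series/=.
    under eq_bigr do rewrite pB; rewrite telescope_sumr// addrC subrK//.
  by move=> c; apply: is_cvgD => //; exact: is_cvg_cst.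
pose S' n x : R[i] := S n x * (\1_(~` N) x)%:C.
have SS' n : \forall x \ae mu, S n x = S' n x.
  exists N; split=> // x /= h; apply: contrapT => Nx; apply: h.
  by rewrite /S' indicE mem_set// mulr1.
have mS' n : Cmeasurable (S' n).
  apply: CmeasurableM; first by case: (LS n).
  by split=> //=; apply: measurable_indic; exact: measurableC.
have LS' n : Lpow (S' n).
  split=> //; apply: (intg_ae (u := fun x => cmod (S n x) ^+ q)).
  - by apply: filterS (SS' n) => x ->.
  - exact: measurable_cmodX.
  - by case: (LS n).
have S'cvg x (p : R[i] -> R) : {morph p : z w / z - w} -> (forall z, `|p z| <= cmod z) ->
    cvgn (fun n => p (S' n x)).
  move=> pB pl; have [Nx|Nx] := pselect (N x).
    rewrite /S' indicE memNset//; under eq_fun do rewrite mulr0.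
    exact: is_cvg_cst.
  by rewrite /S' indicE mem_set//; under eq_fun do rewrite mulr1; exact: scvg.
have cRe x : cvgn (fun n => complex.Re (S' n x)).
  by apply: S'cvg => [z w|z]; [rewrite re_addc re_oppc|exact: normr_Re_le].
have cIm x : cvgn (fun n => complex.Im (S' n x)).
  by apply: S'cvg => [z w|z]; [rewrite im_addc im_oppc|exact: normr_Im_le].
pose g x : R[i] := limn (fun n => complex.Re (S' n x)) +i* limn (fun n => complex.Im (S' n x)).
have mg : Cmeasurable g.
  split; [apply: (measurable_fun_cvg (h := fun n x => complex.Re (S' n x)))
         |apply: (measurable_fun_cvg (h := fun n x => complex.Im (S' n x)))].
  - by move=> m; case: (mS' m).
  - by move=> x _; exact: cRe.
  - by move=> m; case: (mS' m).
  - by move=> x _; exact: cIm.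
have key n : intg (fun x => cmod (g x - S' n x) ^+ q) /\
    moment (fun x => g x - S' n x) <= 2 ^+ q.+1 * D n.
  apply: (@Rintegral_fatou _ _ _ mu (fun j x => cmod (S' (n + j)%N x - S' n x) ^+ q)).
  - by move=> j; case: (LpowB (LS' (n + j)%N) (LS' n)).
  - by move=> j x; rewrite exprn_ge0// cmod_ge0.
  - by apply: measurable_cmodX; apply: CmeasurableD => //; exact: CmeasurableN.
  - move=> x; apply: (@cvg_comp _ _ _ (fun j => cmod (S' (n + j)%N x - S' n x))
      (fun t => t ^+ q) _ _ _ _ (@exprn_continuous _ q _)).
    under eq_fun do rewrite cmodE re_addc im_addc re_oppc im_oppc.
    rewrite cmodE re_addc im_addc re_oppc im_oppc.
    apply: (@cvg_comp _ _ _ _ Num.sqrt _ _ _ _ (@sqrt_continuous R _)).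
    have sh (a : nat -> R) : cvgn a -> a (n + j)%N @[j --> \oo] --> limn a.
      by move=> ca; apply: cvg_comp ca; exact: cvg_addnl.
    have sq (a : nat -> R) (l : R) : a @ \oo --> l -> a j ^+ 2 @[j --> \oo] --> l ^+ 2.
      by move=> al; rewrite expr2; under eq_fun do rewrite expr2; exact: cvgM.
    apply: cvgD; apply: sq; (apply: cvgB; last exact: cvg_cst).
      exact: sh (cRe x).
    exact: sh (cIm x).
  - move=> j; rewrite (le_trans _ (tail j n))// le_eqVlt; apply/orP; left; apply/eqP.
    apply: moment_ae; last 2 first.
    + by case: (LpowB (LS' (n + j)%N) (LS' n)).
    + by case: (Lsub (n + j)%N n).
    + by apply: filterS2 (SS' n) (SS' (n + j)%N) => x -> ->.
have Lg : Lpow g.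
  have -> : g = (fun x => (g x - S' 0%N x) + S' 0%N x) by apply/funext => x; rewrite subrK.
  apply: LpowD => //; split; last by case: (key 0%N).
  by apply: CmeasurableD => //; exact: CmeasurableN.
exists g => // n; rewrite (le_trans _ (key n).2)// le_eqVlt; apply/orP; left; apply/eqP.
apply: moment_ae.
- by apply: filterS (SS' n) => x ->.
- by case: (LpowB Lg (LS n)).
- by case: (LpowB Lg (LS' n)).
Qed.

End Completeness.

(** * Multipliers of a closed subspace are bounded *)

Section Multipliers.
Context {d : measure_display} {T : measurableType d} {R : realType}
  (mu : probability T R) (q : nat) (X : set (T -> R[i])).
Hypothesis q_gt0 : (0 < q)%N.
Hypothesis hX : closed_subspace mu q%:R%:E X.
Implicit Types (f g h : T -> R[i]) (u v : T -> R).

Local Notation intg u := (mu.-integrable setT (EFin \o u)).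
Local Notation moment := (moment mu q).
Local Notation Lpow := (Lpow mu q).

Lemma subspace_Lpow f : X f -> Lpow f.
Proof. by move=> /(closed_subspace_sub hX)/CLp_Lpow; apply. Qed.

Lemma subspaceD f g : X f -> X g -> X (fun x => f x + g x).
Proof. exact: closed_subspaceD hX f g. Qed.

Lemma subspaceZ (c : R[i]) f : X f -> X (fun x => c * f x).
Proof. exact: closed_subspaceZ hX c f. Qed.

Lemma subspaceN f : X f -> X (fun x => - f x).
Proof.
move=> /(subspaceZ (-1)); congr X; apply/funext => x; exact: mulN1r.
Qed.

Lemma subspaceB f g : X f -> X g -> X (fun x => f x - g x).
Proof. by move=> Xf Xg; apply: subspaceD => //; exact: subspaceN. Qed.

Lemma subspace_closed f : Lpow f ->
  (forall e : R, 0 < e -> exists2 g, X g & moment (fun x => f x - g x) < e) -> X f.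
Proof.
move=> Lf hf; apply: (closed_subspace_closed hX); split; first exact/CLp_Lpow.
move=> e e0; have [|g Xg fg] := hf (e ^+ q); first by rewrite exprn_gt0.
exists g => //; apply/CLnorm_lt => //.
by apply: LpowB => //; exact: subspace_Lpow.
Qed.

Lemma truncated_moment_cvg f h : Cmeasurable h -> Lpow f ->
  \int[mu]_x (\1_[set x | cmod (h x) <= n%:R] x * cmod (f x) ^+ q) @[n --> \oo]
    --> moment f.
Proof.
move=> mh [mf jf].
have mI n : measurable [set x | cmod (h x) <= n%:R :> R].
  rewrite (_ : [set _ | _] = (fun x => cmod (h x)) @^-1` `]-oo, n%:R]).
    by rewrite -[X in measurable X]setTI; exact: measurable_cmod.
  by apply/seteqP; split=> x /=; rewrite in_itv.
apply: (Rintegral_dominated_cvg _ _ _ jf).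
- move=> n; apply: measurable_funM; first exact: measurable_indic.
  exact: measurable_cmodX.
- exact: measurable_cmodX.
- apply: aeW => x; apply: cvg_near_cst; near=> n.
  rewrite indicE mem_set ?mul1r//=.
  near: n; exact: nbhs_infty_ger.
- apply: aeW => x n; rewrite normrM indicE [X in _ * X]ger0_norm ?exprn_ge0 ?cmod_ge0//.
  by case: (x \in _); rewrite ?normr1 ?mul1r// normr0 mul0r exprn_ge0// cmod_ge0.
Unshelve. all: by end_near. Qed.

(** One step of a gliding hump: inside every ball of [X] there is a smaller ball on
    which multiplication by [h] has large moments.  Truncating [h] makes the
    multiplication continuous, which is what lets the estimate at the new centre
    spread to a ball. *)
Lemma multiplier_hump h : X h -> (forall f, X f -> X (fun x => h x * f x)) ->
  (forall C : R, exists2 f, X f & C * moment f < moment (fun x => h x * f x)) ->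
  forall (S : T -> R[i]) (D : R) (n : nat), X S -> 0 < D ->
  exists (S' : T -> R[i]) (D' : R), [/\ X S', 0 < D', 2 ^+ q.+1 * D' <= D,
    moment (fun x => S' x - S x) <= D &
    forall f, X f -> moment (fun x => f x - S' x) <= 2 ^+ q.+1 * D' ->
      n%:R <= moment (fun x => h x * f x)].
Proof.
move=> Xh hM unbd S D n XS D0.
have p2 m : 0 < (2 : R) ^+ m by rewrite exprn_gt0.
(* half of A is lost in choosing a sign, 1 in truncating, 2 ^+ q in moving the
   centre *)
pose A : R := 2 * (2 ^+ q * n.+1%:R + 1).
have A0 : 0 < A by rewrite mulr_gt0// ltr_pwDr// mulr_ge0// ltW.
have mh : Cmeasurable h by case: (subspace_Lpow Xh).
have LhX f : X f -> Lpow (fun x => h x * f x) by move=> Xf; apply/subspace_Lpow/hM.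
(* a vector of moment at most D whose product with h has moment A *)
have [e Xe [eD eA]] : exists2 e, X e & moment e <= D /\ moment (fun x => h x * e x) = A.
  have [f Xf hf] := unbd (A / D).
  have mhf0 : 0 < moment (fun x => h x * f x).
    by apply: le_lt_trans hf; rewrite mulr_ge0 ?divr_ge0 ?moment_ge0// ltW.
  have t0 : 0 <= A / moment (fun x => h x * f x) by apply: divr_ge0; exact: ltW.
  pose c := (A / moment (fun x => h x * f x)) `^ q%:R^-1.
  have cq : cmod c%:C ^+ q = A / moment (fun x => h x * f x).
    by rewrite cmod_real ger0_norm ?powR_ge0// powR_root.
  exists (fun x => c%:C * f x); first exact: subspaceZ.
  have Lf := subspace_Lpow Xf.
  rewrite momentZ// cq; split.
    rewrite mulrAC ler_pdivrMr// ltW//.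
    by move: hf; rewrite mulrAC ltr_pdivrMr// mulrC [X in _ < X]mulrC.
  have -> : (fun x => h x * (c%:C * f x)) = (fun x => c%:C * (h x * f x)).
    by apply/funext => x; rewrite mulrCA.
  by rewrite momentZ ?cq ?divfK ?gt_eqF//; exact: LhX.
(* 2 h e is the difference of the products of h with S + e and S - e, so one of
   these is large *)
have [S' [XS' S'D S'A]] : exists S', [/\ X S', moment (fun x => S' x - S x) <= D &
    A / 2 <= moment (fun x => h x * S' x)].
  have XD := subspaceD XS Xe; have XB := subspaceB XS Xe.
  have [hp|hp] := leP (A / 2) (moment (fun x => h x * (S x + e x))).
    exists (fun x => S x + e x); split=> //.
    by under [X in moment X]eq_fun do rewrite addrC addKr.
  exists (fun x => S x - e x); split=> //.
    under [X in moment X]eq_fun do rewrite addrC addKr.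
    by rewrite momentN.
  have := momentD (LhX _ XD) (LpowN (LhX _ XB)).
  rewrite momentN.
  have -> : (fun x => h x * (S x + e x) - h x * (S x - e x)) =
      (fun x => 2 * (h x * e x)) by apply/funext => x; ring.
  rewrite momentZ; last exact: LhX.
  have -> : cmod (2 : R[i]) = 2.
    by rewrite (_ : 2 = (2 : R)%:C) ?cmod_real ?ger0_norm// rmorph_nat.
  by rewrite eA ler_pM2l// => ?; lra.
have [N hN] : exists N : nat, A / 2 - 1 <=
    \int[mu]_x (\1_[set x | cmod (h x) <= N%:R] x * cmod (h x * S' x) ^+ q).
  have := truncated_moment_cvg mh (LhX _ XS').
  move=> /cvgrPdist_le/(_ 1 ltr01)[N _ /(_ N (leqnn N))] /= hN.
  exists N; move: hN; rewrite ler_distlC => /andP[]; lra.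
pose D' := Num.min (D / 2 ^+ q.+1) ((N.+1%:R ^+ q * 2 ^+ q.+1)^-1).
have D'0 : 0 < D' by rewrite lt_min divr_gt0//= invr_gt0 mulr_gt0 ?exprn_gt0.
exists S', D'; split=> //.
  by rewrite mulrC -ler_pdivlMr// ge_min lexx.
move=> f Xf fS'.
have small : N.+1%:R ^+ q * moment (fun x => f x - S' x) <= 1.
  apply: (@le_trans _ _ (N.+1%:R ^+ q * (2 ^+ q.+1 * D'))).
    by rewrite ler_pM2l ?exprn_gt0.
  rewrite mulrA mulrC -ler_pdivlMr ?mulr_gt0 ?exprn_gt0// mul1r.
  by rewrite ge_min lexx orbT.
have LS'f : Lpow (fun x => f x - S' x) by apply/subspace_Lpow/subspaceB.
have : A / 2 - 1 <= 2 ^+ q * (moment (fun x => h x * f x) +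
    N.+1%:R ^+ q * moment (fun x => f x - S' x)).
  apply: le_trans hN _.
  rewrite -RintegralZl//; last by case: LS'f.
  rewrite -RintegralD//; last 2 first.
    by case: (LhX _ Xf).
    by apply: intgZ; case: LS'f.
  rewrite -RintegralZl//; last first.
    by apply: intgD; [case: (LhX _ Xf)|apply: intgZ; case: LS'f].
  have mI : measurable [set x | cmod (h x) <= N%:R :> R].
    rewrite (_ : [set _ | _] = (fun x => cmod (h x)) @^-1` `]-oo, N%:R]).
      by rewrite -[X in measurable X]setTI; exact: measurable_cmod.
    by apply/seteqP; split=> x /=; rewrite in_itv.
  apply: le_RintegralT.
  - have [mhS ihS] := LhX _ XS'.
    apply: intg_dominated ihS _.
      by apply: measurable_funM; [exact: measurable_indic|exact: measurable_cmodX].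
    move=> x; rewrite normrM indicE [X in _ * X]ger0_norm ?exprn_ge0 ?cmod_ge0//.
    by case: (x \in _); rewrite ?normr1 ?mul1r// normr0 mul0r exprn_ge0// cmod_ge0.
  - by apply/intgZ/intgD; [case: (LhX _ Xf)|apply: intgZ; case: LS'f].
  - move=> x; have [hx|hx] := leP (cmod (h x)) N%:R; last first.
      rewrite indicE memNset ?mul0r; last by apply/negP; rewrite -ltNge.
      by rewrite mulr_ge0 ?addr_ge0 ?mulr_ge0 ?exprn_ge0 ?cmod_ge0.
    rewrite indicE mem_set// mul1r.
    have -> : h x * S' x = h x * f x + - (h x * (f x - S' x)) by ring.
    apply: le_trans (expr_cmodD _ _ _) _.
    rewrite ler_pM2l// lerD2l cmodN cmodM exprMn ler_wpM2r ?exprn_ge0 ?cmod_ge0//.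
    rewrite lerXn2r ?nnegrE ?cmod_ge0//.
    by rewrite (le_trans hx)// ler_nat.
have -> : A / 2 - 1 = 2 ^+ q * n.+1%:R by rewrite /A; field.
rewrite ler_pM2l// -natr1 => H; lra.
Qed.

(** The closed graph theorem for multiplication by [h]: if it were unbounded,
    nested balls from [multiplier_hump] would shrink to some [g] in [X] whose
    product with [h] has arbitrarily large moment. *)
Lemma multiplier_bounded h : X h -> (forall f, X f -> X (fun x => h x * f x)) ->
  exists2 C : R, 0 < C &
    forall f, X f -> moment (fun x => h x * f x) <= C * moment f.
Proof.
move=> Xh hM; apply: contrapT => nC.
have unbd (C : R) : exists2 f, X f & C * moment f < moment (fun x => h x * f x).
  apply: contrapT => nf; apply: nC; exists (`|C| + 1); first by rewrite ltr_pwDr.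
  move=> f Xf; rewrite leNgt; apply/negP => hf; apply: nf; exists f => //.
  apply: le_lt_trans hf; rewrite ler_wpM2r ?moment_ge0//.
  by rewrite (le_trans (ler_norm _))// lerDl.
have step (s : nat * (T -> R[i]) * R) : exists s' : (T -> R[i]) * R, X s.1.2 -> 0 < s.2 ->
    [/\ X s'.1, 0 < s'.2, 2 ^+ q.+1 * s'.2 <= s.2,
    moment (fun x => s'.1 x - s.1.2 x) <= s.2 &
    forall f, X f -> moment (fun x => f x - s'.1 x) <= 2 ^+ q.+1 * s'.2 ->
      s.1.1%:R <= moment (fun x => h x * f x)].
  have [XS|nXS] := pselect (X s.1.2); last by exists (cst 0, 0).
  have [D0|D0] := ltP 0 s.2; last by exists (cst 0, 0).
  have [S' [D' H]] := multiplier_hump Xh hM unbd s.1.1 XS D0.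
  by exists (S', D').
move=> {nC unbd}; have [F HF] := choice step.
pose st := fix st n := if n is m.+1 then F (m, (st m).1, (st m).2) else (cst 0 : T -> R[i], 1).
have Hst n : X (st n).1 /\ 0 < (st n).2.
  elim: n => [|n [IH1 IH2]] /=; first by split=> //; exact: closed_subspace0 hX.
  by have [] := HF (n, (st n).1, (st n).2) IH1 IH2.
have Hn n := HF (n, (st n).1, (st n).2) (Hst n).1 (Hst n).2.
have [|||||g Lg hg] := @Lpow_complete _ _ _ mu q q_gt0 (fun n => (st n).1) (fun n => (st n).2).
- by move=> n; apply: subspace_Lpow; case: (Hst n).
- by move=> n; case: (Hst n).
- by [].
- by move=> n; case: (Hn n).
- by move=> n; case: (Hn n).
have Dn n : (st n).2 <= 2^-1 ^+ n.
  elim: n => [|n IH]; first by rewrite expr0.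
  rewrite exprS -ler_pdivrMl ?invr_gt0// invrK (le_trans _ IH)//.
  have [_ D0 hD _ _] := Hn n; apply: le_trans hD => /=.
  rewrite ler_pM2r// exprS ler_peMr// exprn_ege1// ler1n//.
have Xg : X g.
  apply: subspace_closed => // e e0.
  have := @cvg_geometric R (2 ^+ q.+1) 2^-1.
  rewrite ger0_norm// invf_lt1// ltr1n => /(_ isT)/cvgr0Pnorm_lt/(_ _ e0).
  move=> [n _ /(_ n (leqnn n))] /=.
  rewrite ger0_norm ?mulr_ge0 ?exprn_ge0 ?invr_ge0// => ne.
  exists (st n).1; first by case: (Hst n).
  apply: le_lt_trans ne; apply: le_trans (hg n) _.
  by rewrite ler_pM2l ?exprn_gt0.
have big n : n%:R <= moment (fun x => h x * g x).
  by have [_ _ _ _] := Hn n; apply => //; exact: hg n.+1.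
have := archi_boundP (moment_ge0 mu q (fun x => h x * g x)).
by rewrite ltNge big.
Qed.

End Multipliers.

Section PowerGrowth.
Context {d : measure_display} {T : measurableType d} {R : realType}
  (mu : probability T R) (q : nat).
Hypothesis q_gt0 : (0 < q)%N.

(** The powers of [cmod (h x) ^+ q / (2 * C)] are summable for almost every [x], so
    this number is less than 1. *)
Lemma bounded_of_power_growth (h : T -> R[i]) (C : R) : 0 < C ->
  (forall j, Lpow mu q (fun x => h x ^+ j)) ->
  (forall j, moment mu q (fun x => h x ^+ j) <= C ^+ j) ->
  exists B : R, \forall x \ae mu, cmod (h x) <= B.
Proof.
move=> C0 Lh hC; pose D := 2 * C; have D0 : 0 < D by rewrite mulr_gt0.
exists (D + 1).
have : \forall x \ae mu, cvgn (series (fun j => D^-1 ^+ j * cmod (h x ^+ j) ^+ q)).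
  apply: (@ae_summable _ _ _ mu (fun j x => D^-1 ^+ j * cmod (h x ^+ j) ^+ q)) => [j|j x|j].
  - by apply: intgZ; case: (Lh j).
  - by rewrite mulr_ge0 ?exprn_ge0 ?invr_ge0 ?cmod_ge0// ltW.
  - rewrite RintegralZl//; last by case: (Lh j).
    rewrite exprVn mulrC ler_pdivrMr ?exprn_gt0//.
    by rewrite /D -exprMn mulKf//; exact: hC.
apply: filterS => x /cvg_series_cvg_0/cvgr0Pnorm_lt/(_ 1 ltr01)[N _ hN].
rewrite leNgt; apply/negP => Dx.
have := hN N (leqnn N) => /=; apply/negP; rewrite -leNgt.
rewrite ger0_norm ?mulr_ge0 ?exprn_ge0 ?invr_ge0 ?cmod_ge0 ?(ltW D0)//.
rewrite cmodX -exprM mulnC exprM -exprMn exprn_ege1//.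
rewrite mulrC ler_pdivlMr// mul1r.
have h1 : 1 <= cmod (h x) by rewrite (le_trans _ (ltW Dx))// lerDr ltW.
rewrite (le_trans _ (ler_eXnr q_gt0 h1))// (le_trans _ (ltW Dx))// lerDl//.
Qed.

End PowerGrowth.

(** * Coefficients of polynomials by interpolation *)

Section Interpolation.

(** The coefficients of a polynomial of bounded degree are fixed linear
    combinations of its values at [0, 1, 2, ...]: integrals of coefficients
    can then be computed, and shown to exist, from integrals of values. *)
Lemma coef_interpolation (F : numFieldType) (n m : nat) :
  exists l : 'I_n -> F, forall p : {poly F}, (size p <= n)%N ->
    p`_m = \sum_(j < n) l j * p.[j%:R].
Proof.
have [mn|nm] := ltnP m n; last first.
  exists (fun=> 0) => p sp; rewrite big1 => [|j _]; last by rewrite mul0r.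
  by rewrite nth_default// (leq_trans sp nm).
pose a : 'rV[F]_n := \row_j (j : nat)%:R.
pose V := Vandermonde n a.
have Vu : V \in unitmx.
  rewrite unitmxE det_Vandermonde unitfE; apply/prodf_neq0 => i _.
  apply/prodf_neq0 => j ij; rewrite !mxE subr_eq0 eqr_nat.
  by rewrite gt_eqF.
exists (fun j => invmx V j (Ordinal mn)) => p sp.
pose c : 'rV[F]_n := \row_i p`_i.
have cV : c *m V = \row_j p.[j%:R].
  apply/rowP => j; rewrite !mxE (horner_coef_wide _ sp).
  by apply: eq_bigr => i _; rewrite !mxE.
have : c 0 (Ordinal mn) = p`_m by rewrite mxE.
rewrite -[c](mulmxK Vu) cV mxE => <-.
by apply: eq_bigr => j _; rewrite mxE mulrC.
Qed.

Lemma coefM1 (F : comNzRingType) (p r : {poly F}) :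
  (p * r)`_1 = p`_0 * r`_1 + p`_1 * r`_0.
Proof. by rewrite coefM !big_ord_recl big_ord0 addr0. Qed.

Lemma coefX0 (F : comNzRingType) (p : {poly F}) n : (p ^+ n)`_0 = p`_0 ^+ n.
Proof.
elim: n => [|n IH]; first by rewrite !expr0 coefC.
by rewrite !exprS coef0M IH.
Qed.

Lemma coefX1 (F : comNzRingType) (p : {poly F}) n :
  (p ^+ n)`_1 = n%:R * p`_1 * p`_0 ^+ n.-1.
Proof.
elim: n => [|n IH]; first by rewrite expr0 coefC /= mul0r mul0r.
rewrite exprS coefM1 coefX0 IH /=; case: n {IH} => [|n] /=.
  by rewrite !expr0 mul0r mul0r mulr0 add0r mul1r.
by rewrite -[n.+2%:R]natr1 exprS; ring.
Qed.

Lemma poly_min0_coef1 (R : realType) (p : {poly R}) :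
  (forall t, p.[0] <= p.[t]) -> p`_1 = 0.
Proof.
move=> pmin.
have d0 : is_derive (0 : R) 1 (horner p) 0.
  have lt11 : (-1 : R) < 0 /\ (0 : R) < 1 by split; [rewrite ltrN10|].
  apply: (@derive1_at_min _ (horner p) (-1) 1).
  - by apply: ltW; apply: lt_trans lt11.1 lt11.2.
  - by move=> t _; apply: ex_derive.
  - by rewrite in_itv/= lt11.1 lt11.2.
  - by move=> t _; exact: pmin.
have d1 : is_derive (0 : R) 1 (horner p) p^`().[0] by exact: is_derive_poly.
have : p^`().[0] = 0 by rewrite -(@derive_val _ _ _ _ _ _ _ d1) (@derive_val _ _ _ _ _ _ _ d0).
by rewrite horner_coef0 coef_deriv mulr1n.
Qed.

End Interpolation.

(** * Orthogonality relations from minimality of moments *)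

Section Graded.
Context {d : measure_display} {T : measurableType d} {R : realType}
  (mu : probability T R) (q : nat).
Implicit Types (f g h : T -> R[i]) (u v : T -> R).

Local Notation intg u := (mu.-integrable setT (EFin \o u)).
Local Notation CI f := (Cintegral mu setT f).

(** Functions that behave like products of [j] functions with finite [q]-th moment;
    the common majorant [u] makes such products integrable for [j <= q] without
    Hoelder's inequality. *)
Definition graded j f := Cmeasurable f /\ exists u,
  [/\ measurable_fun setT u, (forall x, 1 <= u x), intg (fun x => u x ^+ q) &
      forall x, cmod (f x) <= u x ^+ j].

Lemma gradedM i j f g :
  graded i f -> graded j g -> graded (i + j) (fun x => f x * g x).
Proof.
move=> [mf [u [mu' u1 iu fu]]] [mg [v [mv v1 iv gv]]].
split; first exact: CmeasurableM.
pose w x := Num.max (u x) (v x).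
have mw : measurable_fun setT w by exact: measurable_maxr.
have w1 x : 1 <= w x by rewrite le_max u1.
have u0 x : 0 <= u x by rewrite (le_trans _ (u1 x)).
have v0 x : 0 <= v x by rewrite (le_trans _ (v1 x)).
have w0 x : 0 <= w x by rewrite (le_trans _ (w1 x)).
have uw x : u x <= w x by rewrite /w le_max lexx.
have vw x : v x <= w x by rewrite /w le_max lexx orbT.
exists w; split=> //.
  apply: (intg_dominated _ (intgD iu iv)); first exact: measurable_funX.
  move=> x; rewrite ger0_norm ?exprn_ge0// /w.
  by have [_|_] := leP (u x) (v x); rewrite ?lerDl ?lerDr exprn_ge0.
move=> x; rewrite cmodM exprD ler_pM ?cmod_ge0//.
  by apply: le_trans (fu x) _; rewrite lerXn2r ?nnegrE.
by apply: le_trans (gv x) _; rewrite lerXn2r ?nnegrE.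
Qed.

Lemma gradedJ j f : graded j f -> graded j (fun x => (f x)^*).
Proof.
move=> [mf [u [mu' u1 iu fu]]]; split; first exact: CmeasurableJ.
by exists u; split=> // x; rewrite cmodJ.
Qed.

Lemma graded1 : graded 0 (fun _ => 1).
Proof.
split; first exact: Cmeasurable_cst.
exists (fun _ => 1); split=> //; first exact: intg_cst.
by move=> x; rewrite cmod1 expr0.
Qed.

Lemma gradedX f n : graded 1 f -> graded n (fun x => f x ^+ n).
Proof.
move=> gf; elim: n => [|n IH]; first by under eq_fun do rewrite expr0; exact: graded1.
by under eq_fun do rewrite exprS; have := gradedM gf IH; rewrite add1n.
Qed.

Lemma graded_Lpow f : Lpow mu q f -> graded 1 f.
Proof.
move=> [mf jf]; split=> //; exists (fun x => 1 + cmod (f x)).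
have m1 : measurable_fun setT (fun x => 1 + cmod (f x)).
  by apply: measurable_funD => //; exact: measurable_cmod.
split=> //.
- by move=> x; rewrite lerDl cmod_ge0.
- have := intgZ (2 ^+ q) (intgD (intg_cst mu 1) jf).
  move=> /(intg_dominated _); apply; first exact: measurable_funX.
  move=> x; rewrite ger0_norm ?exprn_ge0 ?addr_ge0 ?cmod_ge0//.
  have := expr_cmodD q (1 : R[i]) (cmod (f x))%:C.
  have -> : 1 + (cmod (f x))%:C = (1 + cmod (f x))%:C :> R[i].
    by apply: complex_ext; rewrite /= ?addr0.
  by rewrite cmod1 expr1n !cmod_real !ger0_norm ?addr_ge0 ?cmod_ge0.
- by move=> x; rewrite expr1 lerDr.
Qed.

Lemma graded_integrable j f : (j <= q)%N -> graded j f -> Cintegrable mu f.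
Proof.
move=> jq [mf [u [mu' u1 iu fu]]]; apply: Cintegrable_dominated iu _ => // x.
by apply: le_trans (fu x) _; rewrite ler_weXn2l.
Qed.

Lemma Cintegrable_sum n (l : 'I_n -> R[i]) (F : 'I_n -> T -> R[i]) :
  (forall j, Cintegrable mu (F j)) ->
  Cintegrable mu (fun x => \sum_(j < n) l j * F j x).
Proof.
move=> iF; elim: n l F iF => [|n IH] l F iF.
  under eq_fun do rewrite big_ord0.
  by split; exact: intg_cst.
under eq_fun do rewrite big_ord_recl.
by apply: CintegrableD; [exact: CintegrableZ|exact: IH].
Qed.

Lemma Cintegral_sum n (l : 'I_n -> R[i]) (F : 'I_n -> T -> R[i]) :
  (forall j, Cintegrable mu (F j)) ->
  CI (fun x => \sum_(j < n) l j * F j x) = \sum_(j < n) l j * CI (F j).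
Proof.
move=> iF; elim: n l F iF => [|n IH] l F iF.
  under [X in Cintegral _ _ X]eq_fun do rewrite big_ord0.
  by rewrite big_ord0; apply: complex_ext; rewrite /= Rintegral_cstT.
under [X in Cintegral _ _ X]eq_fun do rewrite big_ord_recl.
rewrite CintegralD ?CintegralZ ?IH ?big_ord_recl//; first exact: CintegrableZ.
by apply: Cintegrable_sum.
Qed.

End Graded.

Section Duality.
Context {d : measure_display} {T : measurableType d} {R : realType}
  (mu : probability T R) (q : nat) (V : set (T -> R[i])).
Implicit Types (f g h phi : T -> R[i]).
Hypothesis V_Lpow : forall g, V g -> Lpow mu q g.
Hypothesis VD : forall f g, V f -> V g -> V (fun x => f x + g x).
Hypothesis VZ : forall (c : R[i]) f, V f -> V (fun x => c * f x).

Local Notation intg u := (mu.-integrable setT (EFin \o u)).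
Local Notation CI f := (Cintegral mu setT f).
Local Notation graded := (graded mu q).

Lemma graded_monomial m a b phi g : graded m phi -> V g ->
  graded (m + a + b) (fun x => phi x * g x ^+ a * (g x)^* ^+ b).
Proof.
move=> gp /V_Lpow/graded_Lpow gg; apply: gradedM; last by apply/gradedX/gradedJ.
by apply: gradedM => //; exact: gradedX.
Qed.

(** Differentiating the relation at [g] in the directions [u] and [i u], and
    separating the part that is linear in [u] from the conjugate-linear one. *)
Lemma orthogonality_step phi m a b : graded m phi -> (m + a + b <= q)%N ->
  (forall g, V g -> CI (fun x => phi x * g x ^+ a * (g x)^* ^+ b) = 0) ->
  forall u, V u ->
  ((0 < a)%N -> forall g, V g ->
    CI (fun x => phi x * u x * g x ^+ a.-1 * (g x)^* ^+ b) = 0) /\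
  ((0 < b)%N -> forall g, V g ->
    CI (fun x => phi x * (u x)^* * g x ^+ a * (g x)^* ^+ b.-1) = 0).
Proof.
move=> gphi mab H.
pose c1 (u g : T -> R[i]) x : R[i] := phi x * u x * g x ^+ a.-1 * (g x)^* ^+ b.
pose c2 (u g : T -> R[i]) x : R[i] := phi x * (u x)^* * g x ^+ a * (g x)^* ^+ b.-1.
have lin u g : V u -> V g ->
    CI (fun x => a%:R * c1 u g x + b%:R * c2 u g x) = 0.
  move=> Vu Vg.
  have [l Hl] := coef_interpolation R[i] (a + b).+1 1.
  pose r x : {poly R[i]} := (phi x)%:P * ((g x)%:P + (u x)%:P * 'X) ^+ a *
    ((g x)^*%:P + (u x)^*%:P * 'X) ^+ b.
  have sl (z w : R[i]) : (size (z%:P + w%:P * 'X)%R <= 2)%N.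
    rewrite (leq_trans (size_polyD _ _))// geq_max (leq_trans (size_polyC_leq1 _))//=.
    have := size_polyMleq w%:P 'X; rewrite size_polyX => h.
    by rewrite (leq_trans h)// addn2 ltnS size_polyC_leq1.
  have sX (p : {poly R[i]}) n : (size p <= 2)%N -> (size (p ^+ n)%R <= n.+1)%N.
    move=> sp; rewrite (leq_trans (size_poly_exp_leq _ _))// ltnS.
    by rewrite -[leqRHS]mul1n leq_mul2r -subn1 leq_subLR addn1 sp orbT.
  have sM (p p' : {poly R[i]}) i j : (size p <= i.+1)%N -> (size p' <= j.+1)%N ->
      (size (p * p')%R <= (i + j).+1)%N.
    by move=> h1 h2; have := size_polyMleq p p'; lia.
  have sr x : (size (r x) <= (a + b).+1)%N.
    rewrite /r.
    have h2 := sX _ b (sl (g x)^* (u x)^*).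
    have h1 := sM _ _ 0%N a (size_polyC_leq1 (phi x)) (sX _ a (sl (g x) (u x))).
    exact: sM h1 h2.
  have r1 x : (r x)`_1 = a%:R * c1 u g x + b%:R * c2 u g x.
    have k0 (z w : R[i]) : (z%:P + w%:P * 'X)`_0 = z.
      by rewrite coefD coefMX coefC /= addr0.
    have k1 (z w : R[i]) : (z%:P + w%:P * 'X)`_1 = w.
      by rewrite coefD coefMX !coefC /= add0r.
    rewrite /r coefM1 coef0M coefM1 !coefX1 !coefX0 !k0 !k1 !coefC /= /c1 /c2.
    ring.
  pose gu (j : nat) x : R[i] := g x + j%:R * u x.
  have Vgu j : V (gu j) by apply: VD => //; exact: VZ.
  have rj j x : (r x).[j%:R] = phi x * gu j x ^+ a * (gu j x)^* ^+ b.
    rewrite /r !hornerE /gu rmorphD rmorphM /= rmorph_nat.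
    by rewrite [j%:R * u x]mulrC [j%:R * (u x)^*]mulrC.
  have -> : (fun x => a%:R * c1 u g x + b%:R * c2 u g x) =
      (fun x => \sum_(j < (a + b).+1) l j * (phi x * gu j x ^+ a * (gu j x)^* ^+ b)).
    by apply/funext => x; rewrite -r1 (Hl _ (sr x)); apply: eq_bigr => j _; rewrite rj.
  rewrite Cintegral_sum.
    by rewrite big1// => j _; rewrite H ?mulr0.
  by move=> j; apply: (graded_integrable mab); apply: graded_monomial.
have i1 u g : V u -> V g -> (0 < a)%N -> Cintegrable mu (c1 u g).
  move=> Vu Vg a0; apply: (@graded_integrable _ _ _ mu q (m + 1 + a.-1 + b)).
    by rewrite -(addnA m) add1n prednK.
  by apply: graded_monomial => //; apply: gradedM => //; exact/graded_Lpow/V_Lpow.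
have i2 u g : V u -> V g -> (0 < b)%N -> Cintegrable mu (c2 u g).
  move=> Vu Vg b0; apply: (@graded_integrable _ _ _ mu q (m + 1 + a + b.-1)).
    by move: mab b0; lia.
  by apply: graded_monomial => //; apply: gradedM => //; exact/gradedJ/graded_Lpow/V_Lpow.
have ia u g : V u -> V g -> Cintegrable mu (fun x => a%:R * c1 u g x).
  move=> Vu Vg; case: (posnP a) => [->|a0]; last exact: CintegrableZ (i1 _ _ Vu Vg a0).
  by under eq_fun do rewrite mul0r; split; exact: intg_cst.
have ib u g : V u -> V g -> Cintegrable mu (fun x => b%:R * c2 u g x).
  move=> Vu Vg; case: (posnP b) => [->|b0]; last exact: CintegrableZ (i2 _ _ Vu Vg b0).
  by under eq_fun do rewrite mul0r; split; exact: intg_cst.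
pose I : R[i] := 0 +i* 1.
have both u g : V u -> V g -> CI (fun x => a%:R * c1 u g x) = 0 /\
    CI (fun x => b%:R * c2 u g x) = 0.
  move=> Vu Vg.
  have Viu : V (fun x => I * u x) by exact: VZ.
  have h1 := lin _ _ Vu Vg; have h2 := lin _ _ Viu Vg.
  have e : (fun x => a%:R * c1 (fun x => I * u x) g x + b%:R * c2 (fun x => I * u x) g x)
      = (fun x => I * (a%:R * c1 u g x - b%:R * c2 u g x)).
    apply/funext => x; rewrite /c1 /c2.
    have -> : (I * u x)^* = - I * (u x)^*.
      by rewrite /I; case: (u x) => s t; apply: complex_ext => /=; ring.
    by ring.
  move: h2; rewrite e CintegralZ; last first.
    have := CintegrableD (ia _ _ Vu Vg) (CintegrableZ (-1) (ib _ _ Vu Vg)).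
    by congr Cintegrable; apply/funext => x; rewrite mulN1r.
  move=> /eqP; rewrite mulf_eq0 => /orP[/eqP[/eqP]|].
    by rewrite oner_eq0.
  rewrite CintegralB; [|exact: ia|exact: ib].
  rewrite subr_eq0 => /eqP h3; move: h1.
  rewrite CintegralD; [|exact: ia|exact: ib].
  rewrite h3 -mulr2n => /eqP; rewrite mulrn_eq0 /= => /eqP ->; by [].
move=> u Vu; split=> [a0|b0] g Vg.
  have := (both _ _ Vu Vg).1; rewrite CintegralZ; last exact: i1.
  by move/eqP; rewrite mulf_eq0 pnatr_eq0 gtn_eqF//= => /eqP.
have := (both _ _ Vu Vg).2; rewrite CintegralZ; last exact: i2.
by move/eqP; rewrite mulf_eq0 pnatr_eq0 gtn_eqF//= => /eqP.
Qed.

End Duality.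

Section FirstVariation.
Context {d : measure_display} {T : measurableType d} {R : realType}
  (mu : probability T R) (k : nat).
Implicit Types (f g h : T -> R[i]).

Local Notation q := (2 * k.+1)%N.
Local Notation intg u := (mu.-integrable setT (EFin \o u)).
Local Notation CI f := (Cintegral mu setT f).

Lemma Rintegral_sum n (l : 'I_n -> R) (F : 'I_n -> T -> R) :
  (forall j, intg (F j)) ->
  intg (fun x => \sum_(j < n) l j * F j x) /\
  \int[mu]_x (\sum_(j < n) l j * F j x) = \sum_(j < n) l j * \int[mu]_x F j x.
Proof.
move=> iF; elim: n l F iF => [|n IH] l F iF.
  have e : (fun x : T => \sum_(j < 0) l j * F j x) = fun=> 0.
    by apply/funext => x; rewrite big_ord0.
  by rewrite e big_ord0 Rintegral_cstT; split => //; exact: intg_cst.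
have e : (fun x : T => \sum_(j < n.+1) l j * F j x) =
    (fun x => l ord0 * F ord0 x + \sum_(j < n) l (lift ord0 j) * F (lift ord0 j) x).
  by apply/funext => x; rewrite big_ord_recl.
have [h1 h2] := IH (fun j => l (lift ord0 j)) (fun j => F (lift ord0 j)) (fun j => iF _).
have h0 := intgZ (l ord0) (iF ord0).
rewrite e; split; first exact: intgD.
by rewrite RintegralD// h2 RintegralZl// big_ord_recl.
Qed.

Lemma sqr_cmod_line (z w : R[i]) (t : R) : cmod (z + t%:C * w) ^+ 2 =
  cmod z ^+ 2 + complex.Re (w * z^*) *+ 2 * t + cmod w ^+ 2 * t ^+ 2.
Proof.
rewrite !sqr_cmod !re_addc !im_addc !re_mulc !im_mulc re_conjc im_conjc /=.
case: z => a b; case: w => c e /=.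
ring.
Qed.

(** The [q]-th moment along a real line is a polynomial in the parameter because
    [q] is even; at a minimum its linear coefficient vanishes. *)
Lemma first_variation_re f g : Lpow mu q f -> Lpow mu q g ->
  (forall t : R, moment mu q g <= moment mu q (fun x => g x + t%:C * f x)) ->
  \int[mu]_x (cmod (g x) ^+ (2 * k) * complex.Re (f x * (g x)^*)) = 0.
Proof.
move=> Lf Lg gmin.
pose r x : {poly R} := ((cmod (g x) ^+ 2)%:P +
  (complex.Re (f x * (g x)^*) *+ 2)%:P * 'X + (cmod (f x) ^+ 2)%:P * 'X^2) ^+ k.+1.
have rt t x : (r x).[t] = cmod (g x + t%:C * f x) ^+ q.
  by rewrite exprM sqr_cmod_line /r !hornerE.
have sr x : (size (r x) <= q.+1)%N.
  rewrite /r (leq_trans (size_poly_exp_leq _ _))// ltnS leq_mul2r; apply/orP; right.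
  set p := (X in size X); suff : (size p <= 3)%N by lia.
  rewrite /p (leq_trans (size_polyD _ _))// geq_max; apply/andP; split.
    rewrite (leq_trans (size_polyD _ _))// geq_max (leq_trans (size_polyC_leq1 _))//=.
    rewrite (leq_trans (size_polyMleq _ _))// size_polyX.
    by rewrite size_polyC; case: (_ != 0).
  rewrite (leq_trans (size_polyMleq _ _))// size_polyXn.
  by rewrite size_polyC; case: (_ != 0).
have r1 x : (r x)`_1 =
    (k.+1%:R * 2) * (cmod (g x) ^+ (2 * k) * complex.Re (f x * (g x)^*)).
  rewrite /r coefX1 !coefD !coefMX !coefMXn !coefC /= !addr0 add0r exprM mulr2n.
  ring.
have it t : intg (fun x => (r x).[t]).
  by under eq_fun do rewrite rt; case: (LpowD Lg (LpowZ t%:C Lf)).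
have im m : intg (fun x => (r x)`_m).
  have [l Hl] := coef_interpolation R q.+1 m.
  have := (Rintegral_sum l (fun j => it j%:R)).1.
  by under eq_fun do rewrite -Hl//.
pose c : {poly R} := \poly_(m < q.+1) \int[mu]_x (r x)`_m.
have ct t : c.[t] = moment mu q (fun x => g x + t%:C * f x).
  rewrite /c horner_poly /moment; under [RHS]eq_Rintegral do rewrite -rt.
  under [RHS]eq_Rintegral do rewrite (horner_coef_wide _ (sr _)).
  under [RHS]eq_Rintegral do under eq_bigr do rewrite mulrC.
  rewrite (Rintegral_sum (fun m : 'I_q.+1 => t ^+ m) (fun j => im j)).2.
  by apply: eq_bigr => m _; rewrite mulrC.
have : c`_1 = 0.
  apply: poly_min0_coef1 => t; rewrite !ct.
  have -> : (fun x => g x + 0%:C * f x) = g.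
    by apply/funext => x; rewrite (_ : 0%:C = 0 :> R[i])// mul0r addr0.
  exact: gmin.
rewrite coef_poly /=; under eq_Rintegral do rewrite r1.
rewrite RintegralZl//.
  by move=> /eqP; rewrite !mulf_eq0 !pnatr_eq0 /= => /eqP.
have := intgZ (k.+1%:R * 2)^-1 (im 1%N); under eq_fun do rewrite r1 mulKf//.
by [].
Qed.

Lemma first_variation f g : Lpow mu q f -> Lpow mu q g ->
  (forall c : R[i], moment mu q g <= moment mu q (fun x => g x + c * f x)) ->
  CI (fun x => f x * g x ^+ k * (g x)^* ^+ k.+1) = 0.
Proof.
move=> Lf Lg gmin.
have e x : f x * g x ^+ k * (g x)^* ^+ k.+1 = (cmod (g x) ^+ (2 * k))%:C * (f x * (g x)^*).
  have -> : (cmod (g x) ^+ (2 * k))%:C = (g x * (g x)^*) ^+ k.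
    by rewrite mulcJ -rmorphXn exprM.
  rewrite exprMn exprS; ring.
under [X in Cintegral _ _ X]eq_fun do rewrite e.
apply: complex_ext => /=; rewrite ?re_mulc ?im_mulc /=.
  under eq_Rintegral do rewrite re_mulc /= mul0r subr0.
  by apply: first_variation_re => // t; exact: gmin.
under eq_Rintegral do rewrite im_mulc /= mul0r addr0.
have := @first_variation_re (fun x => (0 -i* 1) * f x) g (LpowZ _ Lf) Lg.
have -> : (fun x => cmod (g x) ^+ (2 * k) * complex.Re ((0 -i* 1) * f x * (g x)^*)) =
    (fun x => cmod (g x) ^+ (2 * k) * complex.Im (f x * (g x)^*)).
  apply/funext => x; congr (_ * _); rewrite -mulrA re_mulc /= mul0r sub0r mulN1r opprK//.
apply => t; have := gmin (t%:C * (0 -i* 1)).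
by under [X in _ <= moment mu q X -> _]eq_fun do rewrite -mulrA.
Qed.

End FirstVariation.

(** * The algebra of bounded multipliers of the range *)

Section Projection.
Context {d : measure_display} {T : measurableType d} {R : realType}
  (mu : probability T R) (k : nat) (X : set (T -> R[i]))
  (P : (T -> R[i]) -> T -> R[i]).
Implicit Types (f g h u v w : T -> R[i]).

Local Notation q := (2 * k.+1)%N.
Local Notation intg u := (mu.-integrable setT (EFin \o u)).
Local Notation CI f := (Cintegral mu setT f).
Local Notation mom := (moment mu q).

Hypothesis k_gt0 : (0 < k)%N.
Hypothesis hX : closed_subspace mu q%:R%:E X.
Hypothesis X_cst : forall c : R[i], X (fun _ => c).
Hypothesis hP : projection mu X P.
Hypothesis P_contractive : forall f, X f -> mom (P f) <= mom f.
Hypothesis P1 : \forall x \ae mu, P (fun _ => 1) x = 1.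

Let q0 : (0 < q)%N. Proof. by []. Qed.
Let X_Lpow f : X f -> Lpow mu q f := @subspace_Lpow _ _ _ mu q X q0 hX f.
Let X_mf f : X f -> Cmeasurable f. Proof. by move=> /X_Lpow[]. Qed.

(** The elements fixed by [P] up to null sets: all representatives of the range. *)
Definition proj_range u := X u /\ \forall x \ae mu, P u x = u x.
Definition proj_kernel f := X f /\ \forall x \ae mu, P f x = 0.

Lemma proj_sub f : X f -> X (P f). Proof. exact: projection_sub hP f. Qed.

Lemma proj_ae f g : X f -> X g -> (\forall x \ae mu, f x = g x) ->
  \forall x \ae mu, P f x = P g x.
Proof.
move=> Xf Xg fg; have := projection_ae hP Xf Xg.
set A := (X in (X -> _) -> _) => H; have : A by apply: filterS fg.
by move=> /H; apply: filterS => x /(_ Logic.I).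
Qed.

Lemma proj_add f g : X f -> X g ->
  \forall x \ae mu, P (fun x => f x + g x) x = P f x + P g x.
Proof.
by move=> Xf Xg; have := projectionD hP Xf Xg; apply: filterS => x /(_ Logic.I).
Qed.

Lemma proj_scale (c : R[i]) f : X f -> \forall x \ae mu, P (fun x => c * f x) x = c * P f x.
Proof. by move=> Xf; have := projectionZ hP c Xf; apply: filterS => x /(_ Logic.I). Qed.

Lemma range_P f : X f -> proj_range (P f).
Proof.
move=> Xf; split; first exact: proj_sub.
by have := projection_idem hP Xf; apply: filterS => x /(_ Logic.I).
Qed.

Lemma X_ae f g : X f -> Cmeasurable g -> (\forall x \ae mu, f x = g x) -> X g.
Proof.
move=> Xf mg fg; apply: (closed_subspace_ae hX Xf mg).
by apply: filterS fg.
Qed.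

Lemma range_ae f g : proj_range f -> Cmeasurable g -> (\forall x \ae mu, f x = g x) ->
  proj_range g.
Proof.
move=> [Xf Pf] mg fg; have Xg := X_ae Xf mg fg; split=> //.
by apply: filterS3 (proj_ae Xf Xg fg) Pf fg => x <- -> ->.
Qed.

Lemma rangeD f g : proj_range f -> proj_range g -> proj_range (fun x => f x + g x).
Proof.
move=> [Xf Pf] [Xg Pg]; split; first exact: (subspaceD hX).
by apply: filterS3 (proj_add Xf Xg) Pf Pg => x -> -> ->.
Qed.

Lemma rangeZ (c : R[i]) f : proj_range f -> proj_range (fun x => c * f x).
Proof.
move=> [Xf Pf]; split; first exact: (subspaceZ hX).
by apply: filterS2 (proj_scale c Xf) Pf => x -> ->.
Qed.

Lemma range1 : proj_range (fun _ => 1).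
Proof. by split; [exact: X_cst|exact: P1]. Qed.

Lemma range_Lpow f : proj_range f -> Lpow mu q f. Proof. by move=> [/X_Lpow]. Qed.
Lemma kernel_Lpow f : proj_kernel f -> Lpow mu q f. Proof. by move=> [/X_Lpow]. Qed.

Lemma kernel_sub f : X f -> proj_kernel (fun x => f x - P f x).
Proof.
move=> Xf; have XPf := proj_sub Xf; split; first exact: (subspaceB hX).
have XN := subspaceZ hX (-1) XPf.
have e : (fun x => f x - P f x) = (fun x => f x + (-1) * P f x).
  by apply/funext => x; rewrite mulN1r.
rewrite e; apply: filterS3 (proj_add Xf XN) (proj_scale (-1) XPf) (range_P Xf).2 => x -> -> ->.
by rewrite mulN1r subrr.
Qed.

(** [P] maps [g + c f] to [g] without increasing moments. *)
Lemma range_minimal f g (c : R[i]) : proj_kernel f -> proj_range g ->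
  mom g <= mom (fun x => g x + c * f x).
Proof.
move=> [Xf Pf] [Xg Pg]; have XZ := subspaceZ hX c Xf; have XD := subspaceD hX Xg XZ.
have Pgf : \forall x \ae mu, P (fun x => g x + c * f x) x = g x.
  have h : \forall x \ae mu, P (fun x => c * f x) x = 0.
    by apply: filterS2 (proj_scale c Xf) Pf => x -> ->; rewrite mulr0.
  by apply: filterS3 (proj_add Xg XZ) h Pg => x -> -> ->; rewrite addr0.
have <- : mom (P (fun x => g x + c * f x)) = mom g.
  by apply: moment_ae => //; [exact/X_mf/proj_sub|exact: X_mf].
exact: P_contractive.
Qed.

(** The relation with all powers of [g] is differentiated once in the holomorphic
    and twice in the antiholomorphic direction, then evaluated at [g = 1]. *)
Lemma kernel_orthogonal f u v w : proj_kernel f ->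
  proj_range u -> proj_range v -> proj_range w ->
  CI (fun x => f x * u x * (v x)^* * (w x)^*) = 0.
Proof.
move=> kf ru rv rw.
have Lf := kernel_Lpow kf; have gf := graded_Lpow Lf.
have gr g : proj_range g -> graded mu q 1 g by move=> /range_Lpow/graded_Lpow.
have h0 g : proj_range g -> CI (fun x => f x * g x ^+ k * (g x)^* ^+ k.+1) = 0.
  move=> rg; apply: (first_variation Lf (range_Lpow rg)) => c.
  exact: range_minimal.
have step := @orthogonality_step _ _ _ mu q proj_range range_Lpow rangeD rangeZ.
have [|/(_ k_gt0) h1 _] := step f 1%N k k.+1 gf _ h0 u ru; first by lia.
have g1 := gradedM gf (gr _ ru).
have [|_ /(_ isT) h2] := step _ 2%N k.-1 k.+1 g1 _ h1 v rv; first by lia.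
have g2 := gradedM g1 (gradedJ (gr _ rv)).
have [|_ /(_ k_gt0) h3] := step _ 3%N k.-1 k g2 _ h2 w rw; first by lia.
have := h3 _ range1.
by under [X in Cintegral _ _ X]eq_fun do rewrite rmorph1 !expr1n !mulr1.
Qed.

Lemma mul4_integrable f u v w : Lpow mu q f -> Lpow mu q u -> Lpow mu q v ->
  Lpow mu q w -> Cintegrable mu (fun x => f x * u x * v x * w x).
Proof.
move=> Lf Lu Lv Lw.
apply: (@graded_integrable _ _ _ mu q (1 + 1 + 1 + 1)); first by lia.
by do ![apply: gradedM | exact: graded_Lpow].
Qed.

(** [P (h u) - u P h] is orthogonal to [u P h] and to [P (h u)], hence to itself. *)
Lemma range_multiplier h u : X h -> X (fun x => h x * u x) -> proj_range u ->
  \forall x \ae mu, P (fun x => h x * u x) x = P h x * u x.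
Proof.
move=> Xh Xhu ru; pose p := P h; pose w := P (fun x => h x * u x).
have rp : proj_range p := range_P Xh; have rw : proj_range w := range_P Xhu.
have k1 : proj_kernel (fun x => h x - p x) := kernel_sub Xh.
have k2 : proj_kernel (fun x => h x * u x - w x) := kernel_sub Xhu.
pose D x := p x * u x - w x.
have e x : D x * (D x)^* =
    (((h x * u x - w x) * 1 * (p x)^* * (u x)^*
     - (h x * u x - w x) * 1 * 1^* * (w x)^*)
    - ((h x - p x) * u x * (p x)^* * (u x)^*
     - (h x - p x) * u x * 1^* * (w x)^*)).
  rewrite /D conjc1 rmorphB rmorphM; ring.
have int f a b c : proj_kernel f -> proj_range a -> proj_range b -> proj_range c ->
    Cintegrable mu (fun x => f x * a x * (b x)^* * (c x)^*).
  move=> kf ra rb rc; apply: mul4_integrable; [exact: kernel_Lpow|exact: range_Lpow|..].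
    exact/LpowJ/range_Lpow.
  exact/LpowJ/range_Lpow.
have r1 := range1.
have i1 := int _ _ _ _ k2 r1 rp ru; have i2 := int _ _ _ _ k2 r1 r1 rw.
have i3 := int _ _ _ _ k1 ru rp ru; have i4 := int _ _ _ _ k1 ru r1 rw.
have iN f g : Cintegrable mu f -> Cintegrable mu g -> Cintegrable mu (fun x => f x - g x).
  move=> hf hg; have := CintegrableD hf (CintegrableZ (-1) hg).
  by under eq_fun do rewrite mulN1r.
have zero : CI (fun x => D x * (D x)^*) = 0.
  under [X in Cintegral _ _ X]eq_fun do rewrite e.
  rewrite (CintegralB (iN _ _ i1 i2) (iN _ _ i3 i4)) (CintegralB i1 i2) (CintegralB i3 i4).
  by rewrite !kernel_orthogonal// !subrr.
have iD : Cintegrable mu (fun x => D x * (D x)^*).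
  by under eq_fun do rewrite e; exact: (iN _ _ (iN _ _ i1 i2) (iN _ _ i3 i4)).
have jD : intg (fun x => cmod (D x) ^+ 2).
  by have [+ _] := iD; under eq_fun do rewrite mulcJ.
have := congr1 (@complex.Re R) zero; rewrite Cintegral_mulcJ /=.
move=> /(Rintegral_eq0_ae jD (fun x => sqr_ge0 _)).
apply: filterS => x /eqP; rewrite expf_eq0 /= => /eqP /cmod_eq0 /eqP.
by rewrite subr_eq0 => /eqP.
Qed.

Local Notation M := (multiplier_algebra X).

Definition range_algebra n := [/\ proj_range n,
  exists B : R, \forall x \ae mu, cmod (n x) <= B &
  forall u, proj_range u -> proj_range (fun x => n x * u x)].

(** On the range, multiplication by [P h] is [u |-> P (h u)], so contractivity bounds
    it by multiplication by [h]. *)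
Lemma range_algebra_P h : M h -> range_algebra (P h).
Proof.
move=> [Xh hM]; have rp := range_P Xh.
have hM' f : X f -> X (fun x => h x * f x) by exact: hM.
have mul u : proj_range u -> proj_range (fun x => P h x * u x).
  move=> ru; have Xhu := hM' _ ru.1.
  apply: (range_ae (range_P Xhu)); last exact: range_multiplier.
  by apply: CmeasurableM; apply: X_mf; [exact: rp.1|exact: ru.1].
split=> //; have [C C0 hC] := multiplier_bounded q0 hX Xh hM'.
have powers j : proj_range (fun x => P h x ^+ j).
  elim: j => [|j IH]; first by under eq_fun do rewrite expr0; exact: range1.
  by under eq_fun do rewrite exprS; exact: mul.
apply: (bounded_of_power_growth q0 C0) => j; first exact: range_Lpow.
elim: j => [|j IH].
  rewrite /moment; under eq_Rintegral do rewrite expr0 cmod1 expr1n.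
  by rewrite Rintegral_cstT.
have ru := powers j; have Xhu := hM' _ ru.1.
have -> : mom (fun x => P h x ^+ j.+1) = mom (P (fun x => h x * P h x ^+ j)).
  apply: moment_ae; [|exact/X_mf/(powers j.+1).1|exact/X_mf/proj_sub].
  by apply: filterS (range_multiplier Xh Xhu ru) => x ->; rewrite exprS.
apply: le_trans (P_contractive Xhu) _; apply: le_trans (hC _ ru.1) _.
by rewrite exprS ler_pM2l.
Qed.

Lemma range_algebraM n m : range_algebra n -> range_algebra m ->
  range_algebra (fun x => n x * m x).
Proof.
move=> [rn [B nB] Hn] [rm [C mC] Hm]; split; first exact: Hn.
  exists (B * C); apply: filterS2 nB mC => x h1 h2.
  by rewrite cmodM ler_pM ?cmod_ge0.
by move=> u ru; under eq_fun do rewrite -mulrA; apply/Hn/Hm.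
Qed.

Lemma range_algebraD n m : range_algebra n -> range_algebra m ->
  range_algebra (fun x => n x + m x).
Proof.
move=> [rn [B nB] Hn] [rm [C mC] Hm]; split; first exact: rangeD.
  exists (B + C); apply: filterS2 nB mC => x h1 h2.
  by rewrite (le_trans (cmodD _ _))// lerD.
by move=> u ru; under eq_fun do rewrite mulrDl; apply: rangeD; [exact: Hn|exact: Hm].
Qed.

Lemma range_algebraZ (c : R[i]) n : range_algebra n -> range_algebra (fun x => c * n x).
Proof.
move=> [rn [B nB] Hn]; split; first exact: rangeZ.
  exists (cmod c * B); apply: filterS nB => x h1.
  by rewrite cmodM ler_wpM2l ?cmod_ge0.
by move=> u ru; under eq_fun do rewrite -mulrA; apply/rangeZ/Hn.
Qed.

Lemma range_algebra1 : range_algebra (fun _ => 1).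
Proof.
split; first exact: range1.
  by exists 1; apply: aeW => x; rewrite cmod1.
by move=> u ru; under eq_fun do rewrite mul1r.
Qed.

Lemma kernel_orthogonal_algebra f n m : proj_kernel f -> range_algebra n -> range_algebra m ->
  CI (fun x => f x * n x * (m x)^*) = 0.
Proof.
move=> kf [rn _ _] [rm _ _]; have := kernel_orthogonal kf rn rm range1.
by under [X in Cintegral _ _ X]eq_fun do rewrite rmorph1 mulr1.
Qed.

End Projection.

(** * Weak density and approximation in the quadratic mean *)

Section WeakDensity.
Context {d : measure_display} {T : measurableType d} {R : realType}
  (mu : probability T R).
Implicit Types (f g h u v w : T -> R[i]).

Local Notation intg u := (mu.-integrable setT (EFin \o u)).
Local Notation CI f := (Cintegral mu setT f).
Local Notation L2 := (Lpow mu 2).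
Local Notation sq := (moment mu 2).

Lemma L2_mul_integrable f g : L2 f -> L2 g -> Cintegrable mu (fun x => f x * g x).
Proof.
move=> Lf Lg; apply: (@graded_integrable _ _ _ mu 2 (1 + 1)) => //.
by apply: gradedM; exact: graded_Lpow.
Qed.

Lemma Lpow_sq q f : (2 <= q)%N -> Lpow mu q f -> L2 f.
Proof.
move=> q2 Lf; split; first by case: Lf.
have gf := graded_Lpow Lf.
have [+ _] := graded_integrable q2 (gradedM gf (gradedJ gf)).
by under eq_fun do rewrite mulcJ.
Qed.

Lemma sq_sub (t : R[i]) f g : L2 f -> L2 g ->
  sq (fun x => f x - t * g x) =
  sq f - 2 * complex.Re (t^* * CI (fun x => f x * (g x)^*)) + cmod t ^+ 2 * sq g.
Proof.
move=> Lf Lg.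
have iC := L2_mul_integrable Lf (LpowJ Lg).
have iR : intg (fun x => complex.Re (t^* * (f x * (g x)^*))).
  by have [] := CintegrableZ t^* iC.
have -> : complex.Re (t^* * CI (fun x => f x * (g x)^*)) =
    \int[mu]_x complex.Re (t^* * (f x * (g x)^*)).
  by rewrite -CintegralZ.
have i1 : intg (fun x => cmod (f x) ^+ 2) by case: Lf.
have i2 : intg (fun x => cmod (g x) ^+ 2) by case: Lg.
rewrite /moment -!RintegralZl//.
rewrite -RintegralB//; last exact: intgZ.
rewrite -RintegralD//; last 2 first.
  by apply: intgB => //; exact: intgZ.
  exact: intgZ.
apply: eq_Rintegral => x _; rewrite -exprMn -cmodM !sqr_cmod.
rewrite re_addc im_addc re_oppc im_oppc !re_mulc !im_mulc !re_conjc !im_conjc.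
by ring.
Qed.

(** Cauchy-Schwarz in the additive form, with a free weight [l]. *)
Lemma cmod_Cintegral_mul_le f g (l : R) : 0 < l -> L2 f -> L2 g ->
  cmod (CI (fun x => f x * g x)) <= l * sq f + l^-1 * sq g.
Proof.
move=> l0 Lf Lg; apply: le_trans (cmod_Cintegral_le (L2_mul_integrable Lf Lg)) _.
have i1 : intg (fun x => cmod (f x) ^+ 2) by case: Lf.
have i2 : intg (fun x => cmod (g x) ^+ 2) by case: Lg.
rewrite /moment -!RintegralZl//; last exact: Cintegrable_cmod (L2_mul_integrable Lf Lg).
rewrite -RintegralD//; [|exact: intgZ..].
apply: le_RintegralT.
- by apply: intgZ; exact: Cintegrable_cmod (L2_mul_integrable Lf Lg).
- by apply: intgD; exact: intgZ.
- move=> x; rewrite cmodM.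
  rewrite -(ler_pM2l l0) mulrDr [X in _ <= _ + X]mulrA mulfV ?gt_eqF// mul1r.
  have := sqr_ge0 (l * cmod (f x) - cmod (g x)); nra.
Qed.

Lemma truncation_approx u (e : R) : L2 u -> 0 < e ->
  exists (N : nat) v, [/\ (0 < N)%N, Cmeasurable v,
    forall x, cmod (v x) <= N%:R & sq (fun x => u x - v x) <= e].
Proof.
move=> [mu' iu] e0.
pose v n x : R[i] := (\1_[set x | cmod (u x) <= n%:R] x)%:C * u x.
have mI n : measurable [set x | cmod (u x) <= n%:R :> R].
  rewrite (_ : [set _ | _] = (fun x => cmod (u x)) @^-1` `]-oo, n%:R]).
    by rewrite -[X in measurable X]setTI; exact: measurable_cmod.
  by apply/seteqP; split=> x /=; rewrite in_itv.
have mv n : Cmeasurable (v n).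
  apply: CmeasurableM => //; split=> //=; exact: measurable_indic.
have cv : \int[mu]_x (cmod (u x - v n x) ^+ 2) @[n --> \oo] --> \int[mu]_x (0 : R).
  apply: (Rintegral_dominated_cvg _ _ _ iu).
  - by move=> n; apply: measurable_cmodX; apply: CmeasurableD => //; exact: CmeasurableN.
  - exact: measurable_cst.
  - apply: aeW => x; apply: cvg_near_cst; near=> n.
    rewrite /v indicE mem_set ?mul1r ?subrr ?cmod0 ?expr0n//=.
    near: n; exact: nbhs_infty_ger.
  - apply: aeW => x n; rewrite ger0_norm ?sqr_ge0// /v indicE.
    by case: (x \in _); rewrite ?mul1r ?subrr ?cmod0 ?expr0n ?sqr_ge0//= mul0r subr0.
move: cv; rewrite Rintegral_cstT => /cvgr0Pnorm_le/(_ e e0)[N _ hN].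
exists N.+1, (v N); split=> //.
- move=> x; rewrite /v indicE; have [h|h] := boolP (x \in _).
    move: h; rewrite inE /= => h.
    by rewrite mul1r (le_trans h)// ler_nat.
  by rewrite mul0r cmod0.
- by have := hN N (leqnn N); apply: le_trans; exact: ler_norm.
Unshelve. all: by end_near. Qed.

(** Choose [w] almost minimizing the distance of [u] to [W].  The residual
    [r = u - w] is almost orthogonal to [W], hence by density almost orthogonal
    to bounded functions, hence to [u]; as it is almost orthogonal to [w]
    too, it is almost orthogonal to itself. *)
Lemma weak_density_approx (W : set (T -> R[i])) u :
  W (fun _ => 0) ->
  (forall w, W w -> L2 w) ->
  (forall v w, W v -> W w -> W (fun x => v x + w x)) ->
  (forall (c : R[i]) w, W w -> W (fun x => c * w x)) ->
  L2 u ->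
  (forall w v (e : R), W w -> Cmeasurable v -> (forall x, cmod (v x) <= 1) -> 0 < e ->
    exists w', [/\ W w', sq w' <= 1 &
      cmod (CI (fun x => (u x - w x) * (w' x)^*) - CI (fun x => (u x - w x) * v x)) < e]) ->
  forall e : R, 0 < e -> exists2 w, W w & sq (fun x => u x - w x) < e.
Proof.
move=> W0 WL WD WZ Lu dense e e0; apply: contrapT => far.
pose A := [set sq (fun x => u x - w x) | w in W].
have infA : has_inf A.
  split; first by exists (sq (fun x => u x - 0)), (fun _ => 0).
  by exists 0 => _ [w _ <-]; exact: moment_ge0.
pose D := inf A.
have eD : e <= D.
  apply: lb_le_inf; first by case: infA.
  by move=> _ [w Ww <-]; rewrite leNgt; apply/negP => h; apply: far; exists w.
have D0 : 0 < D by exact: lt_le_trans eD.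
have Dle w : W w -> D <= sq (fun x => u x - w x).
  by move=> Ww; apply: ge_inf; [case: infA|exists w].
pose B : R := 4 * (sq u + D + 1) + 1.
have B1 : 1 <= B by rewrite lerDr !mulr_ge0 ?addr_ge0 ?moment_ge0 ?(ltW D0).
pose l := D / (8 * (D + 1)).
have l0 : 0 < l by rewrite divr_gt0// mulr_gt0// addr_gt0.
have [|N [v [N0 mv vN uv]]] := 
    truncation_approx (u := fun x => (u x)^*) (LpowJ Lu) (e := l * D / 8).
  by rewrite divr_gt0// mulr_gt0.
have N0' : 0 < N%:R :> R by rewrite ltr0n.
pose K := Num.min 1 (Num.min (D / (8 * N%:R)) (D / (8 * B))).
have K0 : 0 < K by rewrite !lt_min ltr01 !divr_gt0 ?mulr_gt0// (lt_le_trans _ B1).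
have K1 : K <= 1 by rewrite ge_min lexx.
have KN : N%:R * K <= D / 8.
  apply: (@le_trans _ _ (N%:R * (D / (8 * N%:R)))).
    by rewrite ler_pM2l// !ge_min lexx !orbT.
  by rewrite le_eqVlt; apply/orP; left; apply/eqP; field; rewrite gt_eqF.
have KB : K * B <= D / 8.
  apply: (@le_trans _ _ (D / (8 * B) * B)).
    by rewrite ler_pM2r ?(lt_le_trans _ B1)// !ge_min lexx !orbT.
  by rewrite le_eqVlt; apply/orP; left; apply/eqP; field; rewrite gt_eqF// (lt_le_trans _ B1).
have [_ [w Ww <-] wD] : exists2 y, A y & y < D + K ^+ 2.
  by apply: inf_adherent => //; rewrite exprn_gt0.
pose r x := u x - w x; set J := sq _ in wD.
have Lw := WL _ Ww; have Lr : L2 r by exact: LpowB.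
have JD1 : J <= D + 1 by rewrite (le_trans (ltW wD))// lerD2l expr_le1// ltW.
have DJ : D <= J := Dle _ Ww.
(* moving w by b^-1 c w' would otherwise decrease the distance below D *)
have near_orth w' (b : R) : W w' -> 1 <= b -> sq w' <= b ->
    cmod (CI (fun x => r x * (w' x)^*)) <= K * b.
  move=> Ww' b1 w'b; have b0 : 0 < b by exact: lt_le_trans b1.
  set c := CI _.
  have := Dle (fun x => w x + b^-1%:C * c * w' x) (WD _ _ Ww (WZ _ _ Ww')).
  have -> : (fun x => u x - (w x + b^-1%:C * c * w' x)) =
      (fun x => r x - b^-1%:C * c * w' x) by apply/funext => x; rewrite /r opprD addrA.
  rewrite sq_sub//; last exact: WL.
  rewrite -/c -/J.
  have -> : complex.Re ((b^-1%:C * c)^* * c) = b^-1 * cmod c ^+ 2.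
    by rewrite sqr_cmod; case: (c) => s t /=; ring.
  rewrite cmodM cmod_real ger0_norm ?invr_ge0 ?(ltW b0)// exprMn => h.
  have h2 : b^-1 ^+ 2 * cmod c ^+ 2 * sq w' <= b^-1 * cmod c ^+ 2.
    have -> : b^-1 ^+ 2 * cmod c ^+ 2 * sq w' =
        (b^-1 * cmod c ^+ 2) * (b^-1 * sq w') by ring.
    apply: ler_piMr; first by rewrite mulr_ge0 ?sqr_ge0 ?invr_ge0 ?(ltW b0).
    by rewrite ler_pdivrMl// mulr1.
  have h3 : b^-1 * cmod c ^+ 2 <= K ^+ 2 by lra.
  have h4 : cmod c ^+ 2 <= (K * b) ^+ 2.
    rewrite mulrC ler_pdivrMr// in h3; rewrite exprMn (le_trans h3)//.
    by rewrite ler_pM2l ?exprn_gt0// ler_eXnr.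
  by move: h4; rewrite ler_pXn2r ?nnegrE ?cmod_ge0// mulr_ge0 ?ltW.
have o1 : cmod (CI (fun x => r x * (w x)^*)) <= D / 8.
  apply: le_trans (near_orth w B Ww B1 _) KB.
  have -> : w = (fun x => u x + - r x) by apply/funext => x; rewrite /r opprB addrCA subrr addr0.
  apply: le_trans (momentD Lu (LpowN Lr)) _.
  have -> : 2 ^+ 2 = 4 :> R by ring.
  by rewrite momentN -/J /B; lra.
have o2 : cmod (CI (fun x => r x * v x)) <= D / 8 + D / 8.
  pose v1 x := (N%:R : R)^-1%:C * v x.
  have mv1 : Cmeasurable v1 by apply: CmeasurableM => //; exact: Cmeasurable_cst.
  have v11 x : cmod (v1 x) <= 1.
    by rewrite cmodM cmod_real ger0_norm ?invr_ge0 ?(ltW N0')// mulrC ler_pdivrMr// mul1r.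
  have Lv1 : L2 v1 by apply: (@Lpow_bounded _ _ _ mu 2 _ 1) => //; exact: aeW.
  have [|w' [Ww' w'1 h]] := dense w v1 (D / 8 / N%:R) Ww mv1 v11.
    by rewrite !divr_gt0.
  have := near_orth _ _ Ww' (lexx 1) w'1; rewrite mulr1 => h1.
  have h2 : cmod (CI (fun x => r x * v1 x)) <= K + D / 8 / N%:R.
    rewrite -[CI _](subrK (CI (fun x => r x * (w' x)^*))) addrC.
    apply: le_trans (cmodD _ _) _; rewrite lerD// ltW//.
    by rewrite -cmodN opprB.
  have -> : (fun x => r x * v x) = (fun x => (N%:R : R)%:C * (r x * v1 x)).
    have e1 : (N%:R : R)%:C * (N%:R : R)^-1%:C = 1 :> R[i].
      by apply: complex_ext => /=; rewrite ?mulr0 ?mul0r ?addr0// subr0 mulfV// gt_eqF.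
    by apply/funext => x; rewrite /v1 -[LHS]mul1r -e1; ring.
  rewrite CintegralZ; last exact: L2_mul_integrable.
  rewrite cmodM cmod_real ger0_norm ?(ltW N0')//.
  apply: le_trans (_ : N%:R * (K + D / 8 / N%:R) <= _); first by rewrite ler_pM2l.
  by rewrite mulrDr [X in _ + X]mulrC divfK ?gt_eqF// lerD2r.
have Lv : L2 v by apply: (@Lpow_bounded _ _ _ mu 2 _ N%:R) => //; exact: aeW.
have o3 : cmod (CI (fun x => r x * ((u x)^* - v x))) <= D / 8 + D / 8.
  have Luv : L2 (fun x => (u x)^* - v x) by apply: LpowB => //; exact: LpowJ.
  apply: le_trans (cmod_Cintegral_mul_le l0 Lr Luv) _; rewrite -/J lerD//.
    apply: (@le_trans _ _ (l * (D + 1))); first by rewrite ler_pM2l.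
    by rewrite /l le_eqVlt; apply/orP; left; apply/eqP; field; rewrite gt_eqF// addr_gt0.
  by rewrite mulrC ler_pdivrMr// mulrC mulrA.
have : J%:C = CI (fun x => r x * ((u x)^* - v x)) + CI (fun x => r x * v x)
    - CI (fun x => r x * (w x)^*).
  have Luv : L2 (fun x => (u x)^* - v x) by apply: LpowB => //; exact: LpowJ.
  have i1 := L2_mul_integrable Lr Luv; have i2 := L2_mul_integrable Lr Lv.
  have i3 := L2_mul_integrable Lr (LpowJ Lw).
  rewrite -Cintegral_mulcJ -(CintegralD i1 i2) -(CintegralB (CintegrableD i1 i2) i3).
  by congr Cintegral; apply/funext => x; rewrite -mulrDr subrK -mulrBr -rmorphB.
move=> /(congr1 (@cmod R)); rewrite cmod_real ger0_norm ?moment_ge0// => HJ.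
have h1 := cmodD (CI (fun x => r x * ((u x)^* - v x)) + CI (fun x => r x * v x))
    (- CI (fun x => r x * (w x)^*)).
have h2 := cmodD (CI (fun x => r x * ((u x)^* - v x))) (CI (fun x => r x * v x)).
rewrite cmodN -HJ in h1; lra.
Qed.

End WeakDensity.

(** * The weak-star hypothesis *)

Section WeakStar.
Context {d : measure_display} {T : measurableType d} {R : realType}
  (mu : probability T R).

Lemma CLnorm_infty_le1 (f : T -> R[i]) :
  (CLnorm mu +oo f <= 1)%E <-> \forall x \ae mu, cmod (f x) <= 1.
Proof.
have m1 : (0 < mu setT)%E by rewrite probability_setT lte01.
rewrite /CLnorm unlock; case: ifPn => [_|/negP[]]; last exact: m1.
split.
  by move=> /ess_supP; apply: filterS => x /=; rewrite lee_fin ger0_norm ?cmod_ge0.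
move=> h; apply/ess_supP; apply: filterS h => x /=.
by rewrite lee_fin ger0_norm ?cmod_ge0.
Qed.

Lemma CLp_infty_of_bounded (f : T -> R[i]) : Cmeasurable f ->
  (forall x, cmod (f x) <= 1) -> CLp mu +oo f /\ (CLnorm mu +oo f <= 1)%E.
Proof.
move=> mf f1; have h : (CLnorm mu +oo f <= 1)%E by apply/CLnorm_infty_le1/aeW.
by split=> //; split=> //; exact: le_lt_trans h (ltry _).
Qed.

Lemma CLp1_of_Cintegrable (f : T -> R[i]) : Cintegrable mu f -> CLp mu 1 f.
Proof.
move=> hf; have := (CLp_Lpow mu (q := 1%N) isT f).2; apply; split.
  exact: (Cintegrable_measurable hf).
have -> : (fun x => cmod (f x) ^+ 1) = (fun x => cmod (f x)).
  by apply/funext => x; rewrite expr1.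
exact: Cintegrable_cmod.
Qed.

Lemma weak_star_approx (M : set (T -> R[i])) (v phi : T -> R[i]) (e : R) :
  Linf_ball mu `<=` closure (sum_conj mu M `&` Linf_ball mu) ->
  Cmeasurable v -> (forall x, cmod (v x) <= 1) -> Cintegrable mu phi -> 0 < e ->
  exists h1 h2, [/\ M h1, M h2, Cmeasurable (fun x => h1 x + (h2 x)^*),
    \forall x \ae mu, cmod (h1 x + (h2 x)^*) <= 1 &
    cmod (Cintegral mu setT (fun x => (h1 x + (h2 x)^*) * phi x)
        - Cintegral mu setT (fun x => v x * phi x)) < e].
Proof.
move=> dense mv v1 iphi e0.
have [Lv v1'] := CLp_infty_of_bounded mv v1.
have Lphi := CLp1_of_Cintegrable iphi.
pose V : wstar_Linf mu := exist _ v (mem_set Lv).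
pose F : CLp mu 1 := exist _ phi (mem_set Lphi).
pose B : set (wstar_Linf mu) := [set g | `|wstar_pairing V F - wstar_pairing g F| < e%:C].
(* pairing with phi is an evaluation of the embedding that defines the topology *)
have nB : nbhs V B.
  have c1 : {for V, continuous (@wstar_pairing _ _ _ mu : wstar_Linf mu -> _)}.
    exact: initial_continuous.
  have c2 : {for wstar_pairing V, continuous (fun g : {ptws CLp mu 1 -> Cfield R} => g F)}.
    exact: proj_continuous.
  have c := continuous_comp c1 c2.
  have := (@cvgr_dist_lt _ _ _ _ _ _ _ c) e%:C.
  by rewrite ltcR => /(_ (nbhs_filter V) e0).
have [g [[[h1 [h2 [Mh1 Mh2 gh]]] gb] gB]] := dense V v1' B nB.
have mg : Cmeasurable (val g) by case: (set_mem (valP g)).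
have e1 : val g = (fun x => h1 x + (h2 x)^*) := gh.
exists h1, h2; split=> //.
- by rewrite -e1.
- by rewrite -[X in \forall x \ae _, cmod (X x) <= _]e1; exact/CLnorm_infty_le1.
- move: gB; rewrite /B /= /wstar_pairing /= -normrN opprB normC_cmod ltcR.
  by rewrite e1.
Qed.

End WeakStar.

(** * Measurability of the range *)

Section Range.
Context {d : measure_display} {T : measurableType d} {R : realType}
  (mu : probability T R) (k : nat) (X : set (T -> R[i]))
  (P : (T -> R[i]) -> T -> R[i]).
Implicit Types (f g h u v w : T -> R[i]).

Local Notation q := (2 * k.+1)%N.
Local Notation intg u := (mu.-integrable setT (EFin \o u)).
Local Notation CI f := (Cintegral mu setT f).
Local Notation mom := (moment mu q).

Hypothesis mu_complete : measure_is_complete mu.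
Hypothesis k_gt0 : (0 < k)%N.
Hypothesis hX : closed_subspace mu q%:R%:E X.
Hypothesis X_cst : forall c : R[i], X (fun _ => c).
Hypothesis hP : projection mu X P.
Hypothesis P_contractive : forall f, X f -> mom (P f) <= mom f.
Hypothesis P1 : \forall x \ae mu, P (fun _ => 1) x = 1.

Local Notation M := (multiplier_algebra X).
Local Notation proj_range := (proj_range mu X P).
Local Notation proj_kernel := (proj_kernel mu X P).
Local Notation N := (range_algebra mu X P).

(** The real parts of products [n m^*] span the real part of the self-adjoint
    algebra generated by [N]. *)
Definition real_products : set (T -> R) :=
  [set s | exists n m, [/\ N n, N m & s = fun x => complex.Re (n x * (m x)^*)]].

Lemma real_products_bounded s : real_products s -> ess_bounded mu s.
Proof.
move=> [n [m [[_ [B nB] _] [_ [C mC] _] ->]]]; exists (B * C).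
apply: filterS2 nB mC => x h1 h2; apply: le_trans (normr_Re_le _) _.
by rewrite cmodM cmodJ ler_pM ?cmod_ge0.
Qed.

Let q0 : (0 < q)%N. Proof. by []. Qed.
Let q_ge2 : (2 <= q)%N. Proof. by lia. Qed.

Let N_Lpow n : N n -> Lpow mu q n.
Proof. by move=> [rn _ _]; exact: (range_Lpow hX rn). Qed.

Let N_mf n : N n -> Cmeasurable n. Proof. by move=> /N_Lpow[]. Qed.

Lemma real_products_measurable s : real_products s -> measurable_fun setT s.
Proof.
move=> [n [m [Nn Nm ->]]].
by have [] := CmeasurableM (N_mf Nn) (CmeasurableJ (N_mf Nm)).
Qed.

Lemma real_products1 : real_products (cst 1).
Proof.
have N1 := range_algebra1 X_cst P1.
exists (fun _ => 1), (fun _ => 1); split=> //.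
by apply/funext => x; rewrite conjc1 mulr1.
Qed.

(** [2 Re a Re b = Re (a b) + Re (a conj(b))], and both terms are again products. *)
Lemma real_products_module (g s : T -> R) :
  annihilates mu real_products g -> real_products s ->
  annihilates mu real_products (fun x => g x * s x).
Proof.
move=> [ig Hg] Ks; have is' s' : real_products s' -> intg (fun x => g x * s' x).
  move=> Ks'; apply: intgM_ess_bounded => //; first exact: real_products_measurable.
  exact: real_products_bounded.
split; first exact: is'.
case: Ks => n [m [Nn Nm ->]] _ [n' [m' [Nn' Nm' ->]]].
pose s1 x := complex.Re (n x * n' x * (m x * m' x)^*).
pose s2 x := complex.Re (n x * m' x * (m x * n' x)^*).
have K1 : real_products s1.
  by exists (fun x => n x * n' x), (fun x => m x * m' x); split=> //; exact: range_algebraM.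
have K2 : real_products s2.
  by exists (fun x => n x * m' x), (fun x => m x * n' x); split=> //; exact: range_algebraM.
have e x : g x * complex.Re (n x * (m x)^*) * complex.Re (n' x * (m' x)^*) =
    2^-1 * (g x * s1 x + g x * s2 x).
  rewrite /s1 /s2; case: (n x) => ? ?; case: (m x) => ? ?; case: (n' x) => ? ?.
  by case: (m' x) => ? ? /=; field.
under eq_Rintegral do rewrite e.
rewrite RintegralZl//; last by apply: intgD; exact: is'.
by rewrite RintegralD ?Hg ?addr0 ?mulr0//; exact: is'.
Qed.

Lemma kernel_annihilates f : proj_kernel f ->
  annihilates mu real_products (fun x => complex.Re (f x)) /\
  annihilates mu real_products (fun x => complex.Im (f x)).
Proof.
move=> kf; have Lf := kernel_Lpow hX kf.
have fi : Cintegrable mu f.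
  by apply: (@graded_integrable _ _ _ mu q 1) => //; exact: graded_Lpow.
have key s : real_products s -> CI (fun x => f x * (s x)%:C) = 0.
  move=> [n [m [Nn Nm ->]]].
  have int n' m' : N n' -> N m' -> Cintegrable mu (fun x => f x * n' x * (m' x)^*).
    move=> h1 h2; apply: (@graded_integrable _ _ _ mu q (1 + 1 + 1)); first by lia.
    apply: gradedM; last exact/gradedJ/graded_Lpow/N_Lpow.
    by apply: gradedM; exact/graded_Lpow/N_Lpow || exact: graded_Lpow.
  have orth := kernel_orthogonal_algebra k_gt0 hX X_cst hP P_contractive P1 kf.
  have e x : f x * (complex.Re (n x * (m x)^*))%:C =
      (2^-1 : R)%:C * (f x * n x * (m x)^* + f x * m x * (n x)^*).
    case: (f x) => ? ?; case: (n x) => ? ?; case: (m x) => ? ?.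
    by apply: complex_ext => /=; field.
  under [X in Cintegral _ _ X]eq_fun do rewrite e.
  rewrite CintegralZ; last by apply: CintegrableD; exact: int.
  by rewrite CintegralD ?orth ?addr0 ?mulr0//; exact: int.
split; split; [by case: fi| |by case: fi|]; move=> s /key /= h.
  have := congr1 (@complex.Re R) h => /= <-.
  by apply: eq_Rintegral => x _; rewrite re_mulc /= mulr0 subr0.
have := congr1 (@complex.Im R) h => /= <-.
by apply: eq_Rintegral => x _; rewrite im_mulc /= mulr0 add0r.
Qed.

Local Notation S := (bisets mu real_products).
Local Notation H := (biannihilator mu real_products).

(** The imaginary part of [n] is the real part of [- i n]. *)
Lemma range_algebra_biannihilator n : N n ->
  H (fun x => complex.Re (n x)) /\ H (fun x => complex.Im (n x)).
Proof.
move=> Nn; have N1 := range_algebra1 X_cst P1.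
have Hs := biannihilator_sub real_products_measurable real_products_bounded.
split; apply: Hs.
  exists n, (fun _ => 1); split=> //; apply/funext => x; by rewrite conjc1 mulr1.
exists (fun x => (0 -i* 1) * n x), (fun _ => 1); split=> //.
  exact: (range_algebraZ hX hP).
by apply/funext => x; rewrite conjc1 mulr1; case: (n x) => s t /=; ring.
Qed.

Lemma range_submeasurable (r : nat) u : (0 < r)%N -> proj_range u ->
  (forall e : R, 0 < e -> exists n m, [/\ N n, N m &
    moment mu r (fun x => u x - (n x + (m x)^*)) < e]) ->
  Lpow mu r u -> (forall n, N n -> Lpow mu r n) ->
  submeasurable S (fun x => complex.Re (u x)) /\
  submeasurable S (fun x => complex.Im (u x)).
Proof.
move=> r0 ru approx Lu NL.
have sS := sigma_algebra_bisets real_products_measurable real_products_bounded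
  real_products1 real_products_module.
have nS := bisets_negligible real_products_measurable real_products_bounded
  real_products1 (mu:=mu) mu_complete.
have ray := bisets_ray real_products_measurable real_products_bounded
  real_products1 real_products_module.
have main (p : R[i] -> R) : (forall z : R[i], `|p z| <= cmod z) ->
    (forall z z' : R[i], p (z - z') = p z - p z') ->
    (forall f, Cmeasurable f -> measurable_fun setT (fun x => p (f x))) ->
    (forall n m, N n -> N m -> H (fun x => p (n x + (m x)^*))) ->
    submeasurable S (fun x => p (u x)).
  move=> pl pB mp Hp.
  apply: (submeasurable_approx sS nS r0) => e e0.
  have [n [m [Nn Nm nm]]] := approx e e0.
  have Lr : Lpow mu r (fun x => u x - (n x + (m x)^*)).
    by apply: LpowB => //; apply: LpowD; [exact: NL|apply: LpowJ; exact: NL].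
  have le x : `|p (n x + (m x)^*) - p (u x)| ^+ r <= cmod (u x - (n x + (m x)^*)) ^+ r.
    by rewrite lerXn2r ?nnegrE ?cmod_ge0// -cmodN opprB -pB.
  have ir : intg (fun x => `|p (n x + (m x)^*) - p (u x)| ^+ r).
    apply: intg_dominated (Lr.2) _.
      apply: measurable_funX; apply: measurableT_comp => //.
      apply: measurable_funB; apply: mp; last by case: Lu.
      by apply: CmeasurableD; [exact: N_mf|apply: CmeasurableJ; exact: N_mf].
    by move=> x; rewrite ger0_norm ?exprn_ge0.
  exists (fun x => p (n x + (m x)^*)); split=> //.
    by apply: (submeasurable_rays sS) => a; apply: ray; exact: Hp.
  by apply: le_lt_trans nm; apply: le_RintegralT => //; case: Lr.
split; apply: main.
- exact: normr_Re_le.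
- by move=> z w; rewrite re_addc re_oppc.
- by move=> f [].
- move=> n m /range_algebra_biannihilator[hn _] /range_algebra_biannihilator[hm _].
  under eq_fun do rewrite re_addc re_conjc.
  exact: biannihilatorD.
- exact: normr_Im_le.
- by move=> z w; rewrite im_addc im_oppc.
- by move=> f [].
- move=> n m /range_algebra_biannihilator[_ hn] /range_algebra_biannihilator[_ hm].
  under eq_fun do rewrite im_addc im_conjc -mulN1r.
  by apply: biannihilatorD => //; exact: biannihilatorZ.
Qed.

Let N0 : N (fun _ => 0).
Proof.
have := range_algebraZ hX hP 0 (range_algebra1 X_cst P1).
by under eq_fun do rewrite mul0r.
Qed.

(** [P] fixes [u] and is contractive, so it carries approximations of [u] by
    multipliers [h] to approximations by [P h]. *)
Lemma approx_of_dense u : X `<=` CLp_closure mu q%:R%:E M -> proj_range u ->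
  forall e : R, 0 < e -> exists n m, [/\ N n, N m &
    mom (fun x => u x - (n x + (m x)^*)) < e].
Proof.
move=> dense [Xu Pu] e e0; have [_ /(_ (e `^ q%:R^-1))] := dense _ Xu.
rewrite powR_gt0// => /(_ isT)[h Mh uh]; have Xh := Mh.1.
have Xuh : X (fun x => u x - h x) by exact: (subspaceB hX).
have uh' : mom (fun x => u x - h x) < e.
  rewrite -[e](powR_root q0) ?(ltW e0)//.
  by apply/(CLnorm_lt q0 (subspace_Lpow q0 hX Xuh)) => //; exact: powR_gt0.
exists (P h), (fun _ => 0); split=> //.
  exact: (range_algebra_P k_gt0 hX X_cst hP P_contractive P1).
apply: le_lt_trans uh'; apply: le_trans (P_contractive Xuh).
have XPh := proj_sub hP Xh.
have XN := subspaceZ hX (-1) Xh.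
rewrite le_eqVlt; apply/orP; left; apply/eqP; apply: moment_ae.
- have e1 : (fun x => u x - h x) = (fun x => u x + (-1) * h x).
    by apply/funext => x; rewrite mulN1r.
  rewrite e1; apply: filterS3 (proj_add hP Xu XN) (proj_scale hP (-1) Xh) Pu => x -> -> ->.
  by rewrite conjc0 addr0 mulN1r.
- under eq_fun do rewrite conjc0 addr0.
  by have [] := subspace_Lpow q0 hX (subspaceB hX Xu XPh).
- by have [] := subspace_Lpow q0 hX (proj_sub hP Xuh).
Qed.

Let Lpow2 f (Lf : Lpow mu q f) : Lpow mu 2 f := @Lpow_sq _ _ _ mu q f q_ge2 Lf.

(** Functions of the form [a + conj b] with [a], [b] in the range are orthogonal to
    the kernel and to its conjugate. *)
Lemma kernel_harmonic f a b : proj_kernel f -> proj_range a -> proj_range b ->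
  CI (fun x => (a x + (b x)^*) * f x) = 0 /\
  CI (fun x => (a x + (b x)^*) * (f x)^*) = 0.
Proof.
move=> kf ra rb; have r1 := range1 X_cst P1.
have orth := kernel_orthogonal k_gt0 hX X_cst hP P_contractive P1 kf.
have Lf := Lpow2 (kernel_Lpow hX kf).
have La := Lpow2 (range_Lpow hX ra); have Lb := Lpow2 (range_Lpow hX rb).
have z1 c : proj_range c -> CI (fun x => c x * f x) = 0.
  move=> rc; have := orth _ _ _ rc r1 r1.
  under [X in Cintegral _ _ X = _ -> _]eq_fun do rewrite conjc1 !mulr1 mulrC.
  by [].
have z2 c : proj_range c -> CI (fun x => (c x)^* * f x) = 0.
  move=> rc; have := orth _ _ _ r1 rc r1.
  under [X in Cintegral _ _ X = _ -> _]eq_fun do rewrite conjc1 !mulr1 mulrC.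
  by [].
have Lc c : Lpow mu 2 c -> Cintegrable mu (fun x => c x * f x).
  by move=> ?; exact: L2_mul_integrable.
have key a' b' : proj_range a' -> proj_range b' -> Lpow mu 2 a' -> Lpow mu 2 b' ->
    CI (fun x => (a' x + (b' x)^*) * f x) = 0.
  move=> ra' rb' La' Lb'.
  under [X in Cintegral _ _ X = _]eq_fun do rewrite mulrDl.
  by rewrite (CintegralD (Lc _ La') (Lc _ (LpowJ Lb'))) z1// z2// addr0.
split; first exact: key.
have -> : (fun x => (a x + (b x)^*) * (f x)^*) =
    (fun x => ((b x + (a x)^*) * f x)^*).
  by apply/funext => x; rewrite rmorphM rmorphD /= conjcK addrC.
rewrite CintegralJ ?key ?conjc0//.
exact: (Lc _ (LpowD Lb (LpowJ La))).
Qed.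

Lemma moment_le1 f : Cmeasurable f -> (\forall x \ae mu, cmod (f x) <= 1) ->
  moment mu 2 f <= 1.
Proof.
move=> mf f1; have [_ jf] : Lpow mu 2 f by exact: Lpow_bounded f1.
rewrite -lee_fin /moment /Rintegral fineK; last exact: integrable_fin_num.
have -> : 1%:E = (\int[mu]_(x in setT) (cst 1%:E x))%E.
  by rewrite integral_cst// mul1e; exact/esym/probability_setT.
apply: ae_ge0_le_integral => //.
- by move=> x _; rewrite lee_fin sqr_ge0.
- exact: (measurable_int _ jf).
- by apply: filterS f1 => x h _; rewrite lee_fin expr_le1// cmod_ge0.
Qed.

(** For a bounded function [h1 + conj h2] the density condition of
    [weak_density_approx] is witnessed by the conjugate of
    [E = P h1 + conj (P h2)]: the difference [D] of [h1 + conj h2] and [E] is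
    orthogonal to functions [a + conj b] of the range, so [E] has the same integral against
    [u - w] and, by Pythagoras, a smaller quadratic mean. *)
Lemma approx_of_weak_star u :
  Linf_ball mu `<=` closure (sum_conj mu M `&` Linf_ball mu) -> proj_range u ->
  forall e : R, 0 < e -> exists n m, [/\ N n, N m &
    moment mu 2 (fun x => u x - (n x + (m x)^*)) < e].
Proof.
move=> dense ru e e0.
pose W : set (T -> R[i]) := [set w | exists n m, [/\ N n, N m & w = fun x => n x + (m x)^*]].
have Lu := Lpow2 (range_Lpow hX ru).
have LN n : N n -> Lpow mu 2 n by move=> /N_Lpow/Lpow2.
have ZN c n : N n -> N (fun x => c * n x) by exact: (range_algebraZ hX hP).
have WL w : W w -> Lpow mu 2 w.
  by move=> [n [m [Nn Nm ->]]]; apply: LpowD; [exact: LN|apply: LpowJ; exact: LN].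
have W0 : W (fun _ => 0).
  by exists (fun _ => 0), (fun _ => 0); split=> //; apply/funext => x; rewrite conjc0 addr0.
have WD v w : W v -> W w -> W (fun x => v x + w x).
  move=> [n [m [Nn Nm ->]]] [n' [m' [Nn' Nm' ->]]].
  exists (fun x => n x + n' x), (fun x => m x + m' x).
  split; [exact: (range_algebraD hX hP)..|apply/funext => x].
  by rewrite rmorphD /=; ring.
have WZ (c : R[i]) w : W w -> W (fun x => c * w x).
  move=> [n [m [Nn Nm ->]]]; exists (fun x => c * n x), (fun x => c^* * m x).
  split; [exact: ZN..|apply/funext => x].
  by rewrite rmorphM /= conjcK mulrDr.
suff dense' w v (e1 : R) : W w -> Cmeasurable v -> (forall x, cmod (v x) <= 1) -> 0 < e1 ->
    exists w', [/\ W w', moment mu 2 w' <= 1 &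
      cmod (CI (fun x => (u x - w x) * (w' x)^*) - CI (fun x => (u x - w x) * v x)) < e1].
  have [_ [n [m [Nn Nm ->]]] h] := weak_density_approx W0 WL WD WZ Lu dense' e0.
  by exists n, m.
move=> [n [m [Nn Nm ew]]] mv v1 e10.
pose a x := u x - n x; pose b x := - m x.
have ra : proj_range a.
  have := rangeD hX hP ru (rangeZ hX hP (-1) (let: And3 h _ _ := Nn in h)).
  by under eq_fun do rewrite mulN1r.
have rb : proj_range b.
  have := rangeZ hX hP (-1) (let: And3 h _ _ := Nm in h).
  by under eq_fun do rewrite mulN1r.
have er x : u x - w x = a x + (b x)^*.
  by rewrite ew /a /b rmorphN opprD addrA.
have Lr : Lpow mu 2 (fun x => u x - w x).
  by apply: LpowB => //; apply: WL; exists n, m.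
have Lv : Lpow mu 2 v by apply: (@Lpow_bounded _ _ _ mu 2 _ 1) => //; exact: aeW.
have ir : Cintegrable mu (fun x => u x - w x).
  have := L2_mul_integrable Lr (Lpow_cst mu 2 1).
  by under eq_fun do rewrite mulr1.
have [h1 [h2 [Mh1 Mh2 mh hb he]]] := weak_star_approx dense mv v1 ir e10.
have Nh1 : N (P h1) by exact: (range_algebra_P k_gt0 hX X_cst hP P_contractive P1).
have Nh2 : N (P h2) by exact: (range_algebra_P k_gt0 hX X_cst hP P_contractive P1).
have k1 := kernel_sub hX hP Mh1.1; have k2 := kernel_sub hX hP Mh2.1.
pose f1 x := h1 x - P h1 x; pose f2 x := h2 x - P h2 x.
pose E x := P h1 x + (P h2 x)^*; pose D x := f1 x + (f2 x)^*.
have Lh h : M h -> Lpow mu 2 h by move=> [Xh _]; exact/Lpow2/(subspace_Lpow q0 hX).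
have Lf1 : Lpow mu 2 f1 by apply: LpowB; [exact: Lh|exact: LN].
have Lf2 : Lpow mu 2 f2 by apply: LpowB; [exact: Lh|exact: LN].
have LE : Lpow mu 2 E by apply: LpowD; [exact: LN|apply: LpowJ; exact: LN].
have LD : Lpow mu 2 D by apply: LpowD => //; exact: LpowJ.
have eED x : h1 x + (h2 x)^* = E x - (-1) * D x.
  by rewrite /E /D /f1 /f2 rmorphB /=; ring.
have orthD c b' : proj_range c -> proj_range b' -> Lpow mu 2 (fun x => c x + (b' x)^*) ->
    CI (fun x => (c x + (b' x)^*) * D x) = 0 /\
    CI (fun x => (c x + (b' x)^*) * (D x)^*) = 0.
  move=> rc rb' L.
  have [z1 z1'] := kernel_harmonic k1 rc rb'.
  have [z2 z2'] := kernel_harmonic k2 rc rb'.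
  split.
    under [X in Cintegral _ _ X]eq_fun do rewrite /D mulrDr.
    rewrite CintegralD; [|exact: L2_mul_integrable..|apply: L2_mul_integrable => //; exact: LpowJ].
    by rewrite z1 z2' addr0.
  under [X in Cintegral _ _ X]eq_fun do rewrite /D rmorphD /= conjcK mulrDr.
  rewrite CintegralD; [|apply: L2_mul_integrable => //; exact: LpowJ|exact: L2_mul_integrable].
  by rewrite z1' z2 addr0.
exists (fun x => P h2 x + (P h1 x)^*); split.
+ by exists (P h2), (P h1).
+ have -> : moment mu 2 (fun x => P h2 x + (P h1 x)^*) = moment mu 2 E.
    rewrite /moment; apply: eq_Rintegral => x _.
    by rewrite -cmodJ rmorphD /= conjcK addrC.
  have : moment mu 2 (fun x => h1 x + (h2 x)^*) <= 1 by exact: moment_le1.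
  under [X in moment mu 2 X <= _ -> _]eq_fun do rewrite eED.
  rewrite sq_sub// (orthD _ _ (let: And3 h _ _ := Nh1 in h) (let: And3 h _ _ := Nh2 in h) LE).2.
  rewrite mulr0 mulr0 subr0 => h; apply: le_trans h.
  by rewrite lerDl mulr_ge0 ?sqr_ge0 ?moment_ge0.
+ have La : Lpow mu 2 (fun x => a x + (b x)^*).
    by under eq_fun do rewrite -er.
  have e2 : CI (fun x => (h1 x + (h2 x)^*) * (u x - w x)) =
      CI (fun x => (u x - w x) * (P h2 x + (P h1 x)^*)^*).
    have -> : (fun x => (h1 x + (h2 x)^*) * (u x - w x)) =
        (fun x => (u x - w x) * E x + (a x + (b x)^*) * D x).
      by apply/funext => x; rewrite -er eED; ring.
    rewrite CintegralD; [|exact: L2_mul_integrable..].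
    rewrite (orthD _ _ ra rb La).1 addr0; congr Cintegral; apply/funext => x.
    by rewrite rmorphD /= conjcK [(P h2 x)^* + _]addrC.
  rewrite -e2; move: he.
  by under [X in _ - Cintegral _ _ X]eq_fun do rewrite mulrC.
Qed.

End Range.

(** * Contractive projections are conditional expectations *)

Lemma moment_contractive (d : measure_display) (T : measurableType d) (R : realType)
    (mu : probability T R) (q : nat) (X : set (T -> R[i]))
    (P : (T -> R[i]) -> T -> R[i]) : (0 < q)%N ->
  closed_subspace mu q%:R%:E X -> projection mu X P ->
  opnorm mu q%:R%:E X P = 1%E ->
  forall f, X f -> moment mu q (P f) <= moment mu q f.
Proof.
move=> q0 hX hP Pn f Xf; apply/ler_addgt0Pr => e e0.
set m := moment mu q f.
have s0 : 0 < m + e by rewrite ltr_wpDl// moment_ge0.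
pose c := (m + e)^-1 `^ q%:R^-1.
have cq : cmod c%:C ^+ q = (m + e)^-1.
  by rewrite cmod_real ger0_norm ?powR_ge0// powR_root// invr_ge0 ltW.
have Xcf := subspaceZ hX c%:C Xf.
have Lf := subspace_Lpow q0 hX Xf.
have XPf := projection_sub hP Xf; have LPf := subspace_Lpow q0 hX XPf.
have LPcf := subspace_Lpow q0 hX (projection_sub hP Xcf).
have : (CLnorm mu q%:R%:E (P (fun x => (c%:C * f x)%R)) <= 1)%E.
  rewrite -Pn; apply: ereal_sup_ubound; exists (fun x => c%:C * f x) => //.
  split=> //; apply/(CLnorm_le1 q0 (subspace_Lpow q0 hX Xcf)).
  by rewrite momentZ// cq ler_pdivrMl// mulr1 lerDl ltW.
move=> /(CLnorm_le1 q0 LPcf).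
have -> : moment mu q (P (fun x => c%:C * f x)) = moment mu q (fun x => c%:C * P f x).
  apply: moment_ae; [|by case: LPcf|by case: (LpowZ c%:C LPf)].
  by have := projectionZ hP c%:C Xf; apply: filterS => x /(_ Logic.I).
by rewrite momentZ// cq ler_pdivrMl// mulr1.
Qed.

Lemma Rintegral_indic (d : measure_display) (T : measurableType d) (R : realType)
    (mu : probability T R) (A : set T) (u : T -> R) :
  \int[mu]_(x in A) u x = \int[mu]_x (u x * \1_A x).
Proof.
rewrite Rintegral_mkcond; apply: eq_Rintegral => x _.
by rewrite patchE indicE; case: (x \in A); rewrite ?mulr1 ?mulr0.
Qed.

Theorem theorem1p7 (R : realType) (d : measure_display) (Omega : measurableType d)
    (mu : probability Omega R) (mu_complete : measure_is_complete mu)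
    (k : nat) (hk : (1 <= k)%N) (p : \bar R) (hp : p = ((2 * k + 2)%:R)%:E)
    (X : set (Omega -> R[i])) (hX : closed_subspace mu p X)
    (X_const : forall c : R[i], X (cst c))
    (hM :
      X `<=` CLp_closure mu p (multiplier_algebra X) \/
      Linf_ball mu `<=`
        closure (sum_conj mu (multiplier_algebra X) `&` Linf_ball mu))
    (P : (Omega -> R[i]) -> Omega -> R[i]) (hP : projection mu X P)
    (P_contractive : opnorm mu p X P = 1%E)
    (P1 : P (cst 1) = cst 1 %[ae mu]) :
  forall f, X f ->
    is_condexp mu (complete_sigma_generated mu (P @` X)) f (P f).
Proof.
have ek : (2 * k + 2 = 2 * k.+1)%N by lia.
rewrite ek in hp; subst p.
have q0 : (0 < 2 * k.+1)%N by [].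
have q2 : (1 + 1 <= 2 * k.+1)%N by lia.
have Pc := moment_contractive q0 hX hP P_contractive.
have P1' : \forall x \ae mu, P (fun _ => 1) x = 1.
  by apply: filterS P1 => x /(_ Logic.I).
pose K := real_products mu X P; pose S := bisets mu K.
have Km : forall s, K s -> measurable_fun setT s.
  by move=> s; exact: (real_products_measurable hX).
have Kb : forall s, K s -> ess_bounded mu s by move=> s; exact: real_products_bounded.
have K1 : K (cst 1) by exact: real_products1 X_const P1'.
have Kmod : forall g s, annihilates mu K g -> K s -> annihilates mu K (fun x => g x * s x).
  by move=> g s; exact: (real_products_module hX).
have sS : sigma_algebra setT S by exact: sigma_algebra_bisets.
have nS : mu.-negligible `<=` S by exact: bisets_negligible.
have range_S u : proj_range mu X P u -> measurable_wrt S u.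
  move=> ru; have Lu := range_Lpow hX ru.
  have NL n : range_algebra mu X P n -> Lpow mu (2 * k.+1) n.
    by move=> [rn _ _]; exact: (range_Lpow hX rn).
  suff [s1 s2] : submeasurable S (fun x => complex.Re (u x)) /\
      submeasurable S (fun x => complex.Im (u x)).
    by split; exact/(submeasurableP sS).
  have rs r := @range_submeasurable _ _ _ mu k X P mu_complete hX X_const hP P1' r u.
  case: hM => [hd|hw].
    apply: (rs (2 * k.+1)%N) => // e e0.
    exact: (approx_of_dense hk hX X_const hP Pc P1' hd ru e0).
  have L2 h : Lpow mu (2 * k.+1) h -> Lpow mu 2 h by exact: Lpow_sq q2.
  apply: (rs 2%N) => //.
  - move=> e e0; exact: (approx_of_weak_star hk hX X_const hP Pc P1' hw ru e0).
  - exact: L2.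
  - by move=> n /NL/L2.
move=> f Xf; have rf := range_P hP Xf; have kf := kernel_sub hX hP Xf.
have gen_S : complete_sigma_generated mu (P @` X) `<=` S.
  move=> A; apply; split=> //; split=> //; first by move=> B [].
  by move=> _ [g Xg <-]; apply: range_S; exact: range_P.
have XPf := proj_sub hP Xf.
have Xi g : X g -> Cintegrable mu g.
  move=> Xg; apply: (@graded_integrable _ _ _ mu (2 * k.+1) 1); first by lia.
  exact/graded_Lpow/(subspace_Lpow q0 hX).
split.
- split=> A hA G [[sG mG hG] nG].
    by apply: (hG (P f) _).1 hA; exists f.
  by apply: (hG (P f) _).2 hA; exists f.
- exact: CLp1_of_Cintegrable (Xi _ XPf).
- move=> A /gen_S [mA [_ bA hA]].
  have [k1 k2] := kernel_annihilates hk hX X_const hP Pc P1' kf.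
  have mI : measurable_fun setT (\1_A : Omega -> R) by exact: measurable_indic.
  have [f1 f2] := Xi _ Xf; have [g1 g2] := Xi _ XPf.
  have intA (a b : Omega -> R) : mu.-integrable setT (EFin \o a) ->
      mu.-integrable setT (EFin \o b) -> \int[mu]_x ((a x - b x) * \1_A x) = 0 ->
      \int[mu]_(x in A) b x = \int[mu]_(x in A) a x.
    move=> ia ib; rewrite (Rintegral_indic mu A a) (Rintegral_indic mu A b).
    under eq_Rintegral do rewrite mulrBl.
    rewrite RintegralB; [|exact: measurableT|exact: intgM_ess_bounded..].
    by move/eqP; rewrite subr_eq0 => /eqP ->.
  apply: complex_ext => /=; apply: intA => //.
    rewrite -[RHS](hA _ k1); apply: eq_Rintegral => x _.
    by rewrite re_addc re_oppc.
  rewrite -[RHS](hA _ k2); apply: eq_Rintegral => x _.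
  by rewrite im_addc im_oppc.
Qed.
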